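(* Let $\gamma:[0,1]\to\mathbb{R}^d$ be a twice-continuously-differentiable unit-speed path such that the map $s\mapsto|\gamma''_s|$ is non-vanishing on $[0,1]$ and is differentiable with bounded derivative. Let $F$, $X_{(i)}$, $Y_{(i)}$, $\mu_n^X$, $\mu_n^Y$ be associated with $\gamma$ as described in the context. Then for every $n\in\mathbb{N}$, $$(n!)^2\|S(\gamma)^n\|^2\ \ge\ \mathbb{E}\left[\exp\left(-n\sum_{k=1}^\infty\frac{1}{k2^k}W_{2k}^{2k}(\mu_n^X,\mu_n^Y)\right)\mathbf{1}_{\{\max_{i=1,\dots,n}|X_{(i)}-Y_{(i)}|<1\}}\right]-\mathbb{P}\left(\max_{i=1,\dots,n}|X_{(i)}-Y_{(i)}|\ge 1\right).$$
   Context: $|\cdot|$ is the Euclidean norm; unit-speed means $|\gamma'_s|=1$ for all $s$. The $n$-th signature term is $S(\gamma)^n=\int_{0\le t_1\le\dots\le t_n\le 1}d\gamma_{t_1}\otimes\cdots\otimes d\gamma_{t_n}\in(\mathbb{R}^d)^{\otimes n}$, and $\|\cdot\|$ is the Hilbert-Schmidt norm, i.e. the norm of the inner product with $\langle v_1\otimes\cdots\otimes v_n,w_1\otimes\cdots\otimes w_n\rangle=\prod_i\langle v_i,w_i\rangle$. Associated objects: $a<b$ are real numbers and $F:[a,b]\to[0,1]$ is a cumulative distribution function, twice differentiable on $(a,b)$, with $F(t)=\int_a^t|\gamma''_{F(s)}|^{-1}ds$, $F(a)=0$, $F(b)=1$ (such $a,b,F$ exist for the given $\gamma$). $\{U_{(i)}\}_{i=1}^n$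 and $\{V_{(i)}\}_{i=1}^n$ are two independent collections, each being the increasing order statistics of $n$ i.i.d. uniform random variables on $[0,1]$. Set $X_{(i)}:=F^{-1}(U_{(i)})$, $Y_{(i)}:=F^{-1}(V_{(i)})$, $\mu_n^X:=\frac1n\sum_{i=1}^n\delta_{X_{(i)}}$, $\mu_n^Y:=\frac1n\sum_{i=1}^n\delta_{Y_{(i)}}$. $W_p$ is the $p$-Wasserstein distance on probability measures on $\mathbb{R}$: $W_p^p(\mu,\nu)=\inf_\pi\int\int|x-y|^p\,d\pi(x,y)$ over couplings $\pi$ of $\mu,\nu$. The series in the exponent takes values in $[0,\infty]$, with $\exp(-\infty)=0$. *)

(* Defs.v *)
From HB Require Import structures.
From mathcomp Require Import all_boot all_order all_algebra.
From mathcomp Require Import all_classical all_reals all_analysis.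
Import Order.TTheory GRing.Theory Num.Theory.
Import numFieldNormedType.Exports.

Set Implicit Arguments.
Unset Strict Implicit.
Unset Printing Implicit Defensive.

Local Open Scope classical_set_scope.
Local Open Scope ring_scope.

(* The canonical norm of 'rV[R]_d in MathComp-Analysis is the sup norm, hence
   an explicit Euclidean norm (the topologies agree). *)
Definition enorm (R : realType) (d : nat) (v : 'rV[R]_d) : R :=
  Num.sqrt (\sum_(i < d) v 0 i ^+ 2).

(* Differentiability relative to [0, 1]: only parameters s in [0, 1] enter the
   difference quotients, so the derivatives at 0 and 1 are one-sided and the
   values of f outside [0, 1] are irrelevant. *)
Definition quot01 (R : realType) (V : normedModType R) (f : R -> V) (t s : R)
  : V := (s - t)^-1 *: (f s - f t).

Definition derivable01 (R : realType) (V : normedModType R) (f : R -> V) : Prop :=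
  forall t : R, t \in `[0, 1] -> cvg (quot01 f t @ within `[0, 1] t^').

Definition derive01 (R : realType) (V : normedModType R) (f : R -> V) (t : R)
  : V := lim (quot01 f t @ within `[0, 1] t^').

Definition C2_01 (R : realType) (V : normedModType R) (f : R -> V) : Prop :=
  [/\ derivable01 f, derivable01 (derive01 f) &
      {within `[0, 1], continuous (derive01 (derive01 f))}].

(* Tensors in (R^d)^{(x) n}, as families of coordinates in the basis
   e_{w_1} (x) ... (x) e_{w_n}. *)
Definition tensor (R : realType) (d n : nat) : Type :=
  {ffun n.-tuple 'I_d -> R}.

Definition pure_tensor (R : realType) (d n : nat) (v : 'I_n -> 'rV[R]_d)
  : tensor R d n := [ffun w : n.-tuple 'I_d => \prod_(i < n) v i 0 (tnth w i)].

Definition hs_inner (R : realType) (d n : nat) (A B : tensor R d n) : R :=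
  \sum_(w : n.-tuple 'I_d) A w * B w.

Definition hs_norm (R : realType) (d n : nat) (A : tensor R d n) : R :=
  Num.sqrt (hs_inner A A).

Lemma hs_inner_pure (R : realType) (d n : nat) (v w : 'I_n -> 'rV[R]_d) :
  hs_inner (pure_tensor v) (pure_tensor w) =
  \prod_(i < n) \sum_(j < d) v i 0 j * w i 0 j.
Proof.
rewrite bigA_distr_bigA /hs_inner.
rewrite (reindex (fun g : {ffun 'I_n -> 'I_d} => [tuple g i | i < n])) /=.
  apply: eq_bigr => g _; rewrite !ffunE -big_split /=.
  by apply: eq_bigr => i _; rewrite tnth_mktuple.
exists (fun t : n.-tuple 'I_d => [ffun i => tnth t i]) => [g _|t _].
  by apply/ffunP => i; rewrite ffunE tnth_mktuple.
by apply: eq_from_tnth => i; rewrite tnth_mktuple ffunE.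
Qed.

(* For w = w_1 ... w_n, the integral over s <= t_1 <= ... <= t_n <= 1 of
   d gamma^{w_1}_{t_1} ... d gamma^{w_n}_{t_n}, as an iterated integral with t_1
   outermost; d gamma_t = gamma'_t dt as the paths considered are C^1. *)
Fixpoint iterated_integral (R : realType) (d : nat) (gamma : R -> 'rV[R]_d)
    (w : seq 'I_d) (s : R) : R :=
  if w is i :: w' then
    \int[@lebesgue_measure R]_(t in `[s, 1])
      (derive01 gamma t 0 i * iterated_integral gamma w' t)
  else 1.

Definition signature (R : realType) (d : nat) (gamma : R -> 'rV[R]_d) (n : nat)
  : tensor R d n := [ffun w : n.-tuple 'I_d => iterated_integral gamma w 0].

Definition is_cdf_on (R : realType) (a b : R) (F : R -> R) : Prop :=
  [/\ forall t : R, t \in `[a, b] -> 0 <= F t <= 1,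
      {in `[a, b] &, {homo F : x y / x <= y}},
      forall t : R, t \in `[a, b[ -> F x @[x --> t^'+] --> F t,
      F a = 0 & F b = 1].

Definition speed_cdf (R : realType) (d : nat) (gamma : R -> 'rV[R]_d) (a b : R)
    (F : R -> R) : Prop :=
  [/\ is_cdf_on a b F,
      forall t : R, t \in `]a, b[ -> derivable F t 1 /\ derivable (derive1 F) t 1 &
      forall t : R, t \in `[a, b] ->
        F t = \int[@lebesgue_measure R]_(s in `[a, t])
                (enorm (derive01 (derive01 gamma) (F s)))^-1].

(* Mutual independence of a finite family: taking some A i := setT gives the
   product rule over every subfamily. *)
Definition mutually_independent (R : realType) (disp : measure_display)
    (T : measurableType disp) (P : probability T R) (n : nat)
    (Z : 'I_n -> T -> R) : Prop :=
  forall A : 'I_n -> set R, (forall i, measurable (A i)) ->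
    P (\bigcap_(i in [set: 'I_n]) Z i @^-1` A i) =
    (\prod_(i < n) P (Z i @^-1` A i))%E.

(* Independence of the random vectors (Y_i)_{i < n} and (Z_i)_{i < n}, tested
   on the pi-systems of measurable rectangles. *)
Definition independent_families (R : realType) (disp : measure_display)
    (T : measurableType disp) (P : probability T R) (n : nat)
    (Y Z : 'I_n -> T -> R) : Prop :=
  forall A B : 'I_n -> set R,
    (forall i, measurable (A i)) -> (forall i, measurable (B i)) ->
    P ((\bigcap_(i in [set: 'I_n]) Y i @^-1` A i) `&`
       (\bigcap_(i in [set: 'I_n]) Z i @^-1` B i)) =
    (P (\bigcap_(i in [set: 'I_n]) Y i @^-1` A i) *
     P (\bigcap_(i in [set: 'I_n]) Z i @^-1` B i))%E.

Definition iid_uniform01 (R : realType) (disp : measure_display)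
    (T : measurableType disp) (P : probability T R) (n : nat)
    (U : 'I_n -> {RV P >-> R}) : Prop :=
  mutually_independent P (fun i => U i : T -> R) /\
  forall i (A : set R), measurable A ->
    distribution P (U i) A = uniform_prob (@ltr01 R) A.

(* Indices are shifted by one: the i-th smallest value is order_stat U i.-1. *)
Definition order_stat (R : realType) (T : Type) (n : nat) (U : 'I_n -> T -> R)
    (i : nat) (omega : T) : R :=
  nth 0 (sort <=%R [seq U j omega | j <- enum 'I_n]) i.

(* n^-1 times the sum of the Dirac masses at x 0, ..., x n.-1. *)
Definition empirical_measure (R : realType) (n : nat) (x : nat -> R)
  : {measure set R -> \bar R} :=
  mscale (n%:R^-1)%:nng (msum (fun i => \d_(x i)) n).

Definition is_coupling (R : realType) (mu nu : {measure set R -> \bar R})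
    (pi : probability (R * R)%type R) : Prop :=
  forall A : set R, measurable A ->
    pi (A `*` [set: R]) = mu A /\ pi ([set: R] `*` A) = nu A.

Definition wasserstein (R : realType) (p : R)
    (mu nu : {measure set R -> \bar R}) : \bar R :=
  poweR (ereal_inf [set (\int[pi]_z (`|z.1 - z.2| `^ p)%:E)%E |
                     pi in [set pi : probability (R * R)%type R |
                             is_coupling mu nu pi]]) p^-1.

(* Main.v *)
Require Import Defs.
From HB Require Import structures.
From mathcomp Require Import all_boot all_order all_algebra.
From mathcomp Require Import all_classical all_reals all_analysis.
From mathcomp Require Import perm measurable_realfun.
From mathcomp Require Import ring lra.
Import Order.TTheory GRing.Theory Num.Theory.
Import numFieldNormedType.Exports.

Set Implicit Arguments.
Unset Strict Implicit.
Unset Printing Implicit Defensive.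

Local Open Scope classical_set_scope.
Local Open Scope ring_scope.

(** The n-th signature coefficients are integrals over the simplex
    t_1 <= ... <= t_n, on which the order statistics of n uniform variables have
    density n!. A coefficient of the word w, times n!, is therefore the
    expectation of the product of the velocity coordinates w_i at the order
    statistics U_(i) [expectation_order_stat]. Its square is an expectation over
    two independent samples, and the sum over all words recombines into inner
    products: (n!)^2 |S^n|^2 is the expectation of the product over i of
    <gamma'(U_(i)), gamma'(V_(i))> [expectation_prod_inner].

    Each factor is then bounded from below. The curve t |-> gamma'(F t) lies on
    the unit sphere and has unit speed, because F' = 1 / |gamma''(F)|; hence
    gamma'(F x) and gamma'(F y) are at distance at most |x - y|, and their inner
    product is at least 1 - (x - y)^2 / 2 [tangent_inner_ge]. If all
    |X_(i) - Y_(i)| are less than 1 these bounds are positive and can be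
    multiplied; otherwise the product of the inner products is still at least -1,
    whence the subtracted probability.

    Finally 1 - x^2 / 2 = exp (- \sum_k x^(2k) / (k 2^k)), and the average over i
    of |X_(i) - Y_(i)|^(2k) is the cost of the monotone matching of the two
    empirical measures, which is at most the cost of any coupling
    [coupling_cost_ge]. So the product of the bounds is at least the exponential
    of the Wasserstein series [exp_exponent_le]. *)

(** * Bounded functions and their integrals *)

Section BoundedFunctions.
Context (R : realType) (d0 : measure_display) (T0 : measurableType d0).

Lemma normr_bool_le1 (b : bool) : `|b%:R : R| <= 1.
Proof. by case: b; rewrite ?normr0 ?normr1 ?ler01. Qed.

Lemma measurable_bool_natr (b : T0 -> bool) :
  measurable_fun setT b -> measurable_fun setT (fun o => (b o)%:R : R).
Proof.
move=> mb.
by apply: (@measurableT_comp _ _ _ _ _ _ (fun c : bool => c%:R : R)).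
Qed.

Lemma measurable_bigmax (I : Type) (s : seq I) (f : I -> T0 -> R) :
  (forall i, measurable_fun setT (f i)) ->
  measurable_fun setT (fun o => \big[Num.max/0]_(i <- s) f i o).
Proof.
move=> mf; elim: s => [|i s IH].
  by under eq_fun do rewrite big_nil; exact: measurable_cst.
by under eq_fun do rewrite big_cons; exact: measurable_maxr.
Qed.

Lemma measurable_mktuple d1 (T1 : measurableType d1) n (Z : 'I_n -> T0 -> T1) :
  (forall i, measurable_fun setT (Z i)) ->
  measurable_fun setT (fun o => [tuple Z i o | i < n]).
Proof.
move=> mZ; apply/measurable_fun_tnthP => j.
rewrite (_ : _ \o _ = Z j)//.
by apply/funext => o /=; rewrite tnth_mktuple.
Qed.

Lemma preimage_rectangle d1 (T1 : measurableType d1) n (Z : 'I_n -> T0 -> T1)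
    (A : 'I_n -> set T1) :
  (fun o => [tuple Z i o | i < n]) @^-1` [set t | forall i, A i (tnth t i)] =
  \bigcap_(i in [set: 'I_n]) Z i @^-1` A i.
Proof.
apply/seteqP; split => o /= H i.
  by move=> _; have := H i; rewrite tnth_mktuple.
by rewrite tnth_mktuple; exact: H.
Qed.

(** The integral of a nonnegative function is a supremum over the simple functions
    below it, so it is monotone on arbitrary functions, such as those built from
    Wasserstein distances. *)
Lemma le_integral_ge0 (mu : {measure set T0 -> \bar R}) (f g : T0 -> \bar R) :
  (forall x, 0 <= f x)%E -> (forall x, f x <= g x)%E ->
  (\int[mu]_x f x <= \int[mu]_x g x)%E.
Proof.
move=> f0 fg; have g0 x : (0 <= g x)%E by exact: le_trans (fg x).
rewrite !ge0_integralTE//; apply: le_ereal_sup => _ [h hf <-].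
by exists h => // x; exact: le_trans (fg x).
Qed.

Lemma bounded_integrable (mu : {finite_measure set T0 -> \bar R}) (f : T0 -> R)
    (M : R) : measurable_fun setT f -> (forall x, `|f x| <= M) ->
  mu.-integrable setT (EFin \o f).
Proof.
move=> mf fM; apply: measurable_bounded_integrable => //.
  exact: fin_num_fun_lty.
exists M; split => [|x Mx]; first exact: num_real.
by move=> y _; apply: le_trans (fM y) (ltW Mx).
Qed.

Lemma bounded_Rintegral_le (P : probability T0 R) (f : T0 -> R) (M : R) :
  measurable_fun setT f -> (forall x, `|f x| <= M) ->
  `|\int[P]_x f x| <= M.
Proof.
move=> mf fM; have fi := bounded_integrable P mf fM.
apply: (le_trans (le_normr_Rintegral _ fi)) => //.
have <- : \int[P]_x (cst M x) = M by rewrite Rintegral_cst//= probability_setT mulr1.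
apply: le_Rintegral => //.
- apply: (@bounded_integrable _ _ M) => [|x]; first exact: measurableT_comp.
  by rewrite normr_id.
- by apply: (@bounded_integrable _ _ `|M|).
Qed.

Lemma Rintegral_indic (P : probability T0 R) (A : set T0) :
  measurable A -> \int[P]_o \1_A o = fine (P A).
Proof. by move=> mA; rewrite /Rintegral integral_indic// setIT. Qed.

Lemma Rintegral_sum (P : probability T0 R) (J : Type) (s : seq J) (f : J -> T0 -> R) :
  (forall j, P.-integrable setT (EFin \o f j)) ->
  \int[P]_o (\sum_(j <- s) f j o) = \sum_(j <- s) \int[P]_o f j o.
Proof.
move=> fi; elim: s => [|j s IH].
  under eq_Rintegral do rewrite big_nil.
  by rewrite big_nil Rintegral_cst// mul0r.
under eq_Rintegral do rewrite big_cons.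
rewrite big_cons -IH RintegralD//.
rewrite (_ : _ \o _ = (fun o => \sum_(j <- s) (EFin \o f j) o)%E).
  exact: integrable_sum.
by apply/funext => o /=; rewrite sumEFin.
Qed.

End BoundedFunctions.

Lemma itv_bounded_integrable (R : realType) (x y : R) (f : R -> R) (M : R) :
  measurable_fun `[x, y] f -> (forall t, t \in `[x, y] -> `|f t| <= M) ->
  lebesgue_measure.-integrable `[x, y] (EFin \o f).
Proof.
move=> mf fM; apply: measurable_bounded_integrable => //.
- by rewrite /= lebesgue_measure_itv/=; case: ifP => _; rewrite ?ltry// -EFinD ltry.
- exists M; split => [|N MN]; first exact: num_real.
  by move=> t txy; apply: le_trans (fM t txy) (ltW MN).
Qed.

(** * Expectations over independent pairs *)

Section IndependentPair.
Context (R : realType) (d0 d1 d2 : measure_display).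
Context (T0 : measurableType d0) (T1 : measurableType d1) (T2 : measurableType d2).

Lemma measurable_Rintegral_param (P : probability T0 R) (Y : T0 -> T2)
    (h : T1 * T2 -> R) (M : R) :
  measurable_fun setT Y ->
  measurable_fun setT h -> (forall z, `|h z| <= M) ->
  measurable_fun setT (fun x => \int[P]_v h (x, Y v)).
Proof.
move=> mY mh hM.
have mhY : measurable_fun setT (fun z : T1 * T0 => h (z.1, Y z.2)).
  apply: measurableT_comp => //; apply: measurable_fun_pair => //.
  exact: measurableT_comp.
(* Adding M makes the integrand nonnegative, the case covered by Tonelli. *)
have mF : measurable_fun setT
    (fun x => \int[P]_v (h (x, Y v) + M)%:E)%E.
  apply: (measurable_fun_fubini_tonelli_F (fun z => (h (z.1, Y z.2) + M)%:E)).
    by apply/measurable_EFinP; apply: measurable_funD.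
  move=> z; rewrite lee_fin -lerBlDr sub0r.
  by have := hM (z.1, Y z.2); rewrite ler_norml => /andP[].
rewrite (_ : (fun x => _) = (fun x => fine (\int[P]_v (h (x, Y v) + M)%:E)%E - M)).
  apply: measurable_funB => //.
  by apply: measurableT_comp mF => //; exact: fine_measurable.
apply/funext => x; rewrite -[X in X - M]/(\int[P]_v (h (x, Y v) + M)).
have mhx : measurable_fun setT (fun v => h (x, Y v)).
  by apply: measurableT_comp => //; apply: measurable_fun_pair.
rewrite (@RintegralD _ _ _ P setT (fun v => h (x, Y v)) (cst M))//.
- by rewrite Rintegral_cst//= probability_setT mulr1 addrK.
- exact: (@bounded_integrable _ _ _ P _ M).
- exact: (@bounded_integrable _ _ _ P _ `|M|).
Qed.

(** The law of an independent pair is the product of the marginal laws, so Fubini's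
    theorem integrates out Y first. *)
Lemma indep_pair_Rintegral (P : probability T0 R) (X : T0 -> T1) (Y : T0 -> T2)
    (h : T1 * T2 -> R) (M : R) :
  measurable_fun setT X -> measurable_fun setT Y ->
  (forall A B, measurable A -> measurable B ->
     P (X @^-1` A `&` Y @^-1` B) = (P (X @^-1` A) * P (Y @^-1` B))%E) ->
  measurable_fun setT h -> (forall z, `|h z| <= M) ->
  \int[P]_w h (X w, Y w) = \int[P]_w \int[P]_v h (X w, Y v).
Proof.
move=> mX mY ind mh hM.
pose X' : {mfun T0 >-> T1} := mfun_Sub (mem_set mX).
pose Y' : {mfun T0 >-> T2} := mfun_Sub (mem_set mY).
have mXY : measurable_fun setT (fun w => (X w, Y w)).
  exact: measurable_fun_pair.
pose XY' : {mfun T0 >-> (T1 * T2)%type} := mfun_Sub (mem_set mXY).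
pose mx : probability T1 R := distribution P X'.
pose my : probability T2 R := distribution P Y'.
pose mxy : probability (T1 * T2)%type R := distribution P XY'.
have prodE : forall C, measurable C -> (mx \x my)%E C = mxy C.
  apply: product_measure_unique => A B mA mB.
  by rewrite /mx /my /distribution /pushforward /= -ind.
have ih : (mx \x my)%E.-integrable setT (EFin \o h).
  pose pp : probability (T1 * T2)%type R := (mx \x my)%E.
  exact: (@bounded_integrable _ _ _ pp h M mh hM).
rewrite /Rintegral; congr fine.
transitivity (\int[mxy]_z (h z)%:E)%E.
  rewrite /mxy integral_distribution//; first exact/measurable_EFinP.
  apply: (@bounded_integrable _ _ _ P (h \o XY') M) => //.
    exact: measurableT_comp.
  by move=> w; exact: hM.
transitivity (\int[mx \x my]_z (h z)%:E)%E.
  by apply: eq_measure_integral => C mC _; apply/esym/prodE.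
rewrite -integral12_prod_meas1//.
have ifin x : (\int[my]_y (h (x, y))%:E = (\int[P]_v h (x, Y v))%:E)%E.
  have mhx : measurable_fun setT (fun y => h (x, y)).
    by apply: measurableT_comp => //.
  rewrite /my integral_distribution//=; last 2 first.
  - exact/measurable_EFinP.
  - by apply: (@bounded_integrable _ _ _ P _ M) => //; exact: (measurableT_comp mhx).
  rewrite /Rintegral fineK//; apply: integrable_fin_num => //.
  by apply: (@bounded_integrable _ _ _ P _ M) => //; exact: (measurableT_comp mhx).
have mF := measurable_Rintegral_param P mY mh hM.
transitivity (\int[mx]_x (\int[P]_v h (x, Y v))%:E)%E.
  by apply: eq_integral => x _; exact: ifin.
rewrite /mx integral_distribution//; first exact/measurable_EFinP.
apply: (@bounded_integrable _ _ _ P _ M) => //=.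
  exact: (measurableT_comp mF).
move=> w; apply: bounded_Rintegral_le => //.
by apply: measurableT_comp => //; apply: measurable_fun_pair.
Qed.

End IndependentPair.

Section TupleRectangles.
Context (R : realType) (d1 : measure_display) (T1 : measurableType d1) (n : nat).

Definition rectangle (A : 'I_n -> set T1) : set (n.-tuple T1) :=
  [set t | forall i, A i (tnth t i)].

Lemma measurable_rectangle (A : 'I_n -> set T1) :
  (forall i, measurable (A i)) -> measurable (rectangle A).
Proof.
move=> mA.
rewrite (_ : rectangle A = \big[setI/setT]_(i < n) ((@tnth _ T1 ^~ i) @^-1` A i)).
  apply: bigsetI_measurable => i _.
  by rewrite -[_ @^-1` _]setTI; exact: measurable_tnth.
rewrite -bigcap_seq; apply/seteqP; split => t.
  by move=> At i _; exact: At.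
by move=> At i; apply: At; rewrite /= mem_index_enum.
Qed.

(** Rectangles are stable under intersection and generate the sigma-algebra of
    tuples. *)
Lemma tuple_measure_unique (m1 m2 : {measure set (n.-tuple T1) -> \bar R}) :
  (m1 setT < +oo)%E ->
  (forall A : 'I_n -> set T1, (forall i, measurable (A i)) ->
     m1 (rectangle A) = m2 (rectangle A)) ->
  forall B, measurable B -> m1 B = m2 B.
Proof.
move=> m1oo m12.
pose G : set (set (n.-tuple T1)) :=
  [set rectangle A | A in [set A | forall i, measurable (A i)]].
have GT : G setT.
  by exists (fun=> setT) => //; apply/seteqP.
apply: (measure_unique G (fun=> setT)) => //.
- apply/seteqP; split.
    rewrite /measurable /=; apply: smallest_sub; first exact: smallest_sigma_algebra.
    rewrite -bigcup_seq => B /= [i _ [C mC <-]]; apply: sub_sigma_algebra.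
    exists (fun j => if j == i then C else setT).
      by move=> j /=; case: ifP.
    rewrite setTI; apply/seteqP; split => t /=.
      by move=> /(_ i); rewrite eqxx.
    by move=> Ct j; case: eqP => [->|].
  apply: smallest_sub; first exact: sigma_algebra_measurable.
  by move=> _ [A mA <-]; exact: measurable_rectangle.
- move=> _ _ [A mA <-] [A' mA' <-]; exists (fun i => A i `&` A' i).
    by move=> i; exact: measurableI.
  apply/seteqP; split => t /=.
    by move=> AA; split=> i; have [] := AA i.
  by move=> [At A't] i; split.
- by apply/seteqP; split=> // t _; exists 0%N.
- by move=> _ [A mA <-]; exact: m12.
Qed.

End TupleRectangles.

(** Both sides are finite measures in B which agree on rectangles. *)
Lemma indep_tuple (R : realType) d0 (T0 : measurableType d0) d1
    (T1 : measurableType d1) (P : probability T0 R) (n : nat)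
    (D : set T0) (Y : T0 -> n.-tuple T1) :
  measurable D -> measurable_fun setT Y ->
  (forall A : 'I_n -> set T1, (forall i, measurable (A i)) ->
     P (D `&` Y @^-1` rectangle A) = (P D * P (Y @^-1` rectangle A))%E) ->
  forall B, measurable B -> P (D `&` Y @^-1` B) = (P D * P (Y @^-1` B))%E.
Proof.
move=> mD mY ind B mB.
pose Y' : {mfun T0 >-> n.-tuple T1} := mfun_Sub (mem_set mY).
have PD : P D \is a fin_num by exact: fin_num_measure.
pose c : {nonneg R} := NngNum (fine_ge0 (measure_ge0 P D)).
have cE : (c%:num%:E = P D)%E by rewrite /= fineK.
pose m1' : {measure set (n.-tuple T1) -> \bar R} := pushforward (mrestr P mD) Y.
pose m1 := m1' mY.
pose m2 : {measure set (n.-tuple T1) -> \bar R} := mscale c (distribution P Y').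
have m1E C : m1 C = P (D `&` Y @^-1` C) by rewrite setIC.
have m2E C : m2 C = (P D * P (Y @^-1` C))%E by rewrite -cE.
rewrite -m1E -m2E; apply: tuple_measure_unique => //.
  by rewrite m1E preimage_setT setIT ltey_eq PD.
by move=> A mA; rewrite m1E m2E ind.
Qed.

(** * Increasing products of i.i.d. uniform variables *)

Section IncreasingProducts.
Context (R : realType) (I : Type) (g : I -> R -> R).
Hypothesis mg : forall i, measurable_fun setT (g i).
Hypothesis g1 : forall i t, `|g i t| <= 1.

(** The recursion is on the least variable, so that integrating it out is one step
    of an iterated integral. *)
Fixpoint increasing_prod (w : seq I) (s : R) (zs : seq R) : R :=
  match w, zs with
  | i :: w', z :: zs' => (s < z)%R%:R * (g i z * increasing_prod w' z zs')
  | _, _ => 1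
  end.

(** For g the coordinates of a velocity, a coordinate of the signature. *)
Fixpoint simplex_integral (w : seq I) (s : R) : R :=
  if w is i :: w' then
    \int[@lebesgue_measure R]_(t in `[s, 1]) (g i t * simplex_integral w' t)
  else 1.

Lemma increasing_prod_le1 w s zs : `|increasing_prod w s zs| <= 1.
Proof.
elim: w s zs => [|i w IH] s [|z zs] /=; rewrite ?normr1//.
by rewrite !normrM mulr_ile1 ?mulr_ge0 ?normr_bool_le1// mulr_ile1.
Qed.

Lemma measurable_increasing_prod n w :
  measurable_fun setT (fun p : R * n.-tuple R => increasing_prod w p.1 p.2).
Proof.
elim: n w => [|n IH] [|i w] /=; try exact: measurable_cst.
  rewrite [X in measurable_fun _ X](_ : _ = cst 1); first exact: measurable_cst.
  by apply/funext => -[s t] /=; rewrite tuple0.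
pose z (p : R * n.+1.-tuple R) : R := tnth p.2 ord0.
have mz : measurable_fun setT z.
  exact: (measurableT_comp (@measurable_tnth _ R n.+1 ord0) measurable_snd).
rewrite [X in measurable_fun _ X](_ : _ = (fun p : R * n.+1.-tuple R =>
   (p.1 < z p)%R%:R * (g i (z p) * increasing_prod w (z p) [tuple of behead p.2]))).
  apply: measurable_funM.
    by apply: measurable_bool_natr; exact: measurable_fun_ltr.
  apply: measurable_funM; first exact: measurableT_comp.
  pose q (p : R * n.+1.-tuple R) : R * n.-tuple R := (z p, [tuple of behead p.2]).
  apply: (measurableT_comp (IH w) (_ : measurable_fun setT q)).
  apply: measurable_fun_pair => //.
  exact: (measurableT_comp (@measurable_behead _ R n)
    (@measurable_snd _ _ R (n.+1.-tuple R))).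
by apply/funext => -[s t]; rewrite /z /= [t in LHS]tuple_eta.
Qed.

End IncreasingProducts.

Section IidUniform.
Context (R : realType) (d0 : measure_display) (T0 : measurableType d0)
  (P : probability T0 R).

Lemma uniform_Rintegral (Z : {RV P >-> R}) (f : R -> R) (M : R) :
  (forall A : set R, measurable A ->
    distribution P Z A = uniform_prob (@ltr01 R) A) ->
  measurable_fun setT f -> (forall t, `|f t| <= M) ->
  \int[P]_w f (Z w) = \int[lebesgue_measure]_(t in `[0, 1]) f t.
Proof.
move=> ZU mf fM.
(* The shift by M makes the integrand nonnegative, as integral_uniform requires. *)
pose h t := f t + M.
have mh : measurable_fun setT h by apply: measurable_funD.
have h0 t : 0 <= h t.
  by have := fM t; rewrite /h ler_norml -lerBlDr sub0r => /andP[].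
have hM t : `|h t| <= M + M.
  by rewrite ger0_norm// /h lerD2r; have := fM t; rewrite ler_norml => /andP[].
have intE : \int[P]_w h (Z w) = \int[lebesgue_measure]_(t in `[0, 1]) h t.
  rewrite /Rintegral; congr fine.
  have mZ : measurable_fun setT (Z : T0 -> measurableTypeR R).
    exact: (measurable_funPT Z).
  pose Z' : {mfun T0 >-> measurableTypeR R} :=
    @mfun_Sub _ _ T0 (measurableTypeR R) Z (mem_set mZ).
  rewrite -[LHS](@ge0_integral_distribution _ _ _ _ _ P Z' (EFin \o h)) => [||y];
    last 2 first.
  - exact/measurable_EFinP.
  - by rewrite /= lee_fin.
  rewrite (@eq_measure_integral _ (measurableTypeR R) R setT
      (uniform_prob (@ltr01 R)) (distribution P Z')); last first.
    by move=> A mA _; exact: ZU.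
  rewrite integral_uniform.
  - by rewrite subr0 invr1 mul1e.
  - exact/measurable_EFinP.
  - by move=> x; rewrite lee_fin.
have L1 : \int[lebesgue_measure]_(t in `[0 : R, 1]) h t =
          \int[lebesgue_measure]_(t in `[0, 1]) f t + M.
  rewrite /h [LHS](@RintegralD _ (measurableTypeR R) R lebesgue_measure _ f (cst M))//.
  - rewrite Rintegral_cst//= lebesgue_measure_itv/= lte_fin ltr01/=.
    by rewrite subr0 mulr1.
  - by apply: (@itv_bounded_integrable _ _ _ f M) => //; exact: measurable_funTS.
  - exact: (@itv_bounded_integrable _ _ _ _ `|M|).
move: intE; rewrite L1 /h.
rewrite [X in X = _ -> _](@RintegralD _ _ _ _ _ (f \o Z) (cst M))//.
- by rewrite Rintegral_cst//= probability_setT mulr1 => /addIr.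
- apply: (@bounded_integrable _ _ _ P _ M) => [|w]; last exact: fM.
  exact: measurableT_comp.
- exact: (@bounded_integrable _ _ _ P _ `|M|).
Qed.

Lemma iid_uniform_lift n (Z : 'I_n.+1 -> {RV P >-> R}) :
  iid_uniform01 Z -> iid_uniform01 (fun i => Z (lift ord0 i)).
Proof.
move=> [indZ ZU]; split => [A mA|i A mA]; last exact: ZU.
pose B (i : 'I_n.+1) : set R := oapp A setT (unlift ord0 i).
have mB i : measurable (B i) by rewrite /B; case: unlift => [j|] /=.
have := indZ B mB; rewrite big_ord_recl /B unlift_none/=.
rewrite preimage_setT probability_setT mul1e => indB.
transitivity (P (\bigcap_i Z i @^-1` oapp A setT (unlift ord0 i))).
  congr (P _); apply/seteqP; split => w /= H i _ /=.
    by case: unliftP => [j ->|_//]; exact: H.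
  by have := H (lift ord0 i) I; rewrite /= liftK.
by rewrite indB; apply: eq_bigr => i _; rewrite liftK.
Qed.

(** The product rule gives independence of the head from rectangles in the tail,
    which determine the law of the tail. *)
Lemma iid_uniform_indep_head n (Z : 'I_n.+1 -> {RV P >-> R}) (A : set R)
    (B : set (n.-tuple R)) :
  iid_uniform01 Z -> measurable A -> measurable B ->
  let Y w := [tuple Z (lift ord0 i) w | i < n] in
  P (Z ord0 @^-1` A `&` Y @^-1` B) = (P (Z ord0 @^-1` A) * P (Y @^-1` B))%E.
Proof.
move=> iidZ mA mB Y.
have [indZ _] := iidZ; have [indY _] := iid_uniform_lift iidZ.
have mY : measurable_fun setT Y by exact: measurable_mktuple.
apply: indep_tuple => //.
  by rewrite -[X in measurable X]setTI; exact: (measurable_funPT (Z ord0)).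
move=> C mC.
have YE : Y @^-1` rectangle C = \bigcap_i Z (lift ord0 i) @^-1` C i.
  exact: preimage_rectangle.
rewrite YE indY//.
pose D (i : 'I_n.+1) : set R := oapp C A (unlift ord0 i).
have mD i : measurable (D i) by rewrite /D; case: unlift => [j|] /=.
transitivity (P (\bigcap_i Z i @^-1` D i)).
  congr (P _); apply/seteqP; split => w /=.
    move=> [HA HC] i _; rewrite /D /=; case: unliftP => [j ->|->//]; exact: HC.
  move=> H; split; first by have := H ord0 I; rewrite /D /= unlift_none.
  by move=> i _; have := H (lift ord0 i) I; rewrite /D /= liftK.
rewrite indZ// big_ord_recl /D unlift_none/=; congr (_ * _)%E.
by apply: eq_bigr => i _; rewrite liftK.
Qed.

End IidUniform.

Section SimplexIntegral.
Context (R : realType) (I : Type) (g : I -> R -> R).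
Hypothesis mg : forall i, measurable_fun setT (g i).
Hypothesis g1 : forall i t, `|g i t| <= 1.
Context (d0 : measure_display) (T0 : measurableType d0) (P : probability T0 R).

Lemma Rintegral_itv_indic (s : R) (f : R -> R) (M : R) : 0 <= s ->
  measurable_fun setT f -> (forall t, `|f t| <= M) ->
  \int[lebesgue_measure]_(t in `[0, 1]) ((s < t)%R%:R * f t) =
  \int[lebesgue_measure]_(t in `[s, 1]) f t.
Proof.
move=> s0 mf fM.
rewrite -Rintegral_itv_obnd_cbnd; last first.
  have fi : lebesgue_measure.-integrable `[s, 1] (EFin \o f).
    by apply: (@itv_bounded_integrable _ _ _ f M) => //; exact: measurable_funTS.
  by apply: integrableS fi => //; exact: subset_itv_oc_cc.
have -> : `]s, 1]%classic = `[0, 1]%classic `&` [set t : R | s < t].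
  apply/seteqP; split => t /=; rewrite !in_itv/=.
    by move=> /andP[st ->]; rewrite (le_trans s0 (ltW st)).
  by move=> [/andP[_ ->] ->].
rewrite Rintegral_mkcondr; apply: eq_Rintegral => t _.
rewrite patchE; case: ifPn; rewrite ?inE ?notin_setE /= => st.
  by rewrite st mul1r.
by move/negP: st => /negbTE ->; rewrite mul0r.
Qed.

(** By induction: given the least variable z, the others contribute the same
    expectation with lower bound z, and integrating over z in [s, 1] is one more
    step of the iterated integral. *)
Lemma expectation_increasing_prod n (Z : 'I_n -> {RV P >-> R}) (w : seq I) (s : R) :
  iid_uniform01 Z -> size w = n -> 0 <= s ->
  \int[P]_o increasing_prod g w s [tuple Z i o | i < n] = simplex_integral g w s.
Proof.
elim: n Z w s => [|n IH] Z [|i w] s //= iidZ.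
  by move=> _ _; rewrite Rintegral_cst//= probability_setT mulr1.
move=> [sw] s0.
pose Y o := [tuple Z (lift ord0 j) o | j < n].
have mY : measurable_fun setT Y by exact: measurable_mktuple.
pose ip (p : R * n.-tuple R) := increasing_prod g w p.1 p.2.
have mip : measurable_fun setT ip by exact: measurable_increasing_prod.
pose h (p : R * n.-tuple R) := (s < p.1)%R%:R * (g i p.1 * ip p).
have mlt : measurable_fun setT (fun z : R => (s < z)%R%:R : R).
  by apply: measurable_bool_natr; exact: measurable_fun_ltr.
have mh : measurable_fun setT h.
  apply: measurable_funM; first exact: measurableT_comp mlt measurable_fst.
  by apply: measurable_funM => //; exact: measurableT_comp (mg i) measurable_fst.
have h1 p : `|h p| <= 1.
  rewrite /h !normrM mulr_ile1 ?mulr_ge0 ?normr_bool_le1//.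
  by rewrite mulr_ile1//; exact: increasing_prod_le1.
(* The least variable is split off and integrated last. *)
transitivity (\int[P]_o h (Z ord0 o, Y o)).
  by apply: eq_Rintegral => o _; rewrite /h /ip /= enum_ordSl /= -map_comp.
rewrite (@indep_pair_Rintegral _ _ _ _ _ _ _ P (Z ord0) Y h 1)//; last first.
  by move=> A B mA mB; exact: iid_uniform_indep_head.
pose K z := \int[P]_v ip (z, Y v).
have mK : measurable_fun setT K.
  apply: (@measurable_Rintegral_param _ _ _ _ _ _ _ P Y ip 1 mY mip) => z.
  exact: increasing_prod_le1.
have K1 z : `|K z| <= 1.
  apply: bounded_Rintegral_le.
    exact: (measurableT_comp mip (measurable_fun_pair _ mY)).
  by move=> v; exact: increasing_prod_le1.
have mipY z : measurable_fun setT (fun v => ip (z, Y v)).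
  by apply: (measurableT_comp mip); apply: measurable_fun_pair.
have hK z : \int[P]_v h (z, Y v) = (s < z)%R%:R * (g i z * K z).
  rewrite /h /= -[in RHS]RintegralZl//.
    rewrite -RintegralZl//.
    apply: (@bounded_integrable _ _ _ P _ 1).
      exact: measurable_funM.
    by move=> v; rewrite normrM mulr_ile1//; exact: increasing_prod_le1.
  apply: (@bounded_integrable _ _ _ P _ 1) => // v.
  exact: increasing_prod_le1.
under eq_Rintegral do rewrite hK.
pose f z := g i z * K z.
have mf : measurable_fun setT f by exact: measurable_funM.
have f1 z : `|f z| <= 1 by rewrite normrM mulr_ile1.
have [_ ZU] := iidZ.
rewrite (@uniform_Rintegral _ _ _ P (Z ord0) (fun z => (s < z)%R%:R * f z) 1
  (ZU ord0)).
- rewrite (Rintegral_itv_indic s0 mf f1).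
  apply: eq_Rintegral => t; rewrite inE/= in_itv/= => /andP[st _].
  rewrite /f /K /ip /= IH//; first exact: iid_uniform_lift.
  exact: le_trans st.
- exact: measurable_funM.
- by move=> t; rewrite normrM mulr_ile1 ?normr_bool_le1.
Qed.

End SimplexIntegral.

Lemma iterated_integral_simplex (R : realType) (d : nat)
    (gamma : R -> 'rV[R]_d) (g : 'I_d -> R -> R) (w : seq 'I_d) (s : R) :
  (forall j t, t \in `[0, 1] -> g j t = derive01 gamma t 0 j) -> 0 <= s ->
  simplex_integral g w s = iterated_integral gamma w s.
Proof.
move=> gE; elim: w s => [//|i w IH] s s0 /=.
apply: eq_Rintegral => t; rewrite inE/= in_itv/= => /andP[st t1].
have t0 := le_trans s0 st.
by rewrite IH// gE// in_itv/= t0.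
Qed.

(** * Order statistics *)

Section SortedSum.
Context (R : realType) (I : Type) (g : I -> R -> R).

Lemma increasing_prodE (w : seq I) (zs : seq R) (s : R) (i0 : I) :
  size w = size zs ->
  increasing_prod g w s zs =
  (path <%R s zs)%:R * \prod_(k < size w) g (nth i0 w k) (nth 0 zs k).
Proof.
elim: w zs s => [|i w IH] [|z zs] s //=; first by rewrite big_ord0 mul1r.
move=> [sz]; rewrite IH// big_ord_recl/=.
by case: (s < z); rewrite ?mul0r//= !mul1r mulrCA.
Qed.

(** Exactly one permutation lists distinct values in increasing order, and the list
    it produces is the sorted one. *)
Lemma sum_perm_increasing_prod n (w : n.-tuple I) (x : 'I_n -> R) :
  injective x -> (forall i, 0 < x i) ->
  \sum_(p : 'S_n) increasing_prod g w 0 [tuple x (p i) | i < n] =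
  \prod_(i < n) g (tnth w i) (nth 0 (sort <=%R [seq x j | j <- enum 'I_n]) i).
Proof.
move=> xinj x0.
case: n => [|n] in w x xinj x0 *.
  rewrite big_ord0 (eq_bigr (fun=> 1)) => [|p _]; last by rewrite tuple0.
  by rewrite sumr_const card_Sn.
pose t : n.+1.-tuple R := [tuple x i | i < n.+1].
pose s := sort <=%R t.
have st : perm_eq s t by rewrite perm_sort.
have /tuple_permP[p sp] := st.
have xp (q : 'S_n.+1) : [tuple tnth t (q i) | i < n.+1] = [tuple x (q i) | i < n.+1].
  by apply: eq_from_tnth => i; rewrite !tnth_mktuple.
have ut : uniq t by rewrite map_inj_uniq// enum_uniq.
have s_lt : path <%R 0 s.
  rewrite path_sortedE; last exact: lt_trans.
  rewrite lt_sorted_uniq_le sort_uniq ut sort_le_sorted !andbT.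
  apply/allP => y; rewrite mem_sort => /mapP[i _ ->]; exact: x0.
rewrite (bigD1 p)//= [X in _ + X]big1 => [|q qp].
  rewrite addr0 (increasing_prodE _ (tnth w ord0)); last first.
    by rewrite size_tuple size_map size_enum_ord.
  have -> : [seq x (p i) | i <- enum 'I_n.+1] = s by rewrite sp xp.
  rewrite s_lt mul1r size_tuple; apply: eq_bigr => i _.
  by rewrite -tnth_nth.
rewrite (increasing_prodE _ (tnth w ord0)); last first.
  by rewrite size_tuple size_map size_enum_ord.
case: (boolP (path _ _ _)) => [q_lt|_]; last by rewrite mul0r.
have qt : perm_eq [tuple x (q i) | i < n.+1] t.
  by apply/tuple_permP; exists q; rewrite xp.
have qs : [tuple x (q i) | i < n.+1] = s :> seq R.
  apply: lt_sorted_eq; [exact: path_sorted q_lt|exact: path_sorted s_lt|].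
  by apply: perm_mem; rewrite (perm_trans qt)// perm_sym.
(* Only p sorts x, so the terms of all other permutations vanish. *)
case/negP: qp; apply/eqP/permP => i; apply: xinj.
move: qs; rewrite sp xp => /val_inj/(congr1 (fun u => tnth u i)).
by rewrite !tnth_mktuple.
Qed.
End SortedSum.

Section OrderStatistics.
Context (R : realType) (d0 : measure_display) (T0 : measurableType d0)
  (P : probability T0 R).

Lemma nth_map_enum n (x : 'I_n -> R) (k : nat) (kn : (k < n)%N) :
  nth 0 [seq x i | i <- enum 'I_n] k = x (Ordinal kn).
Proof.
rewrite (nth_map (Ordinal kn)) ?size_enum_ord//; congr x.
by apply: val_inj; rewrite /= nth_enum_ord.
Qed.

Lemma nth_map_ord n (x : 'I_n -> R) (k : 'I_n) :
  nth 0 [seq x i | i <- enum 'I_n] k = x k.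
Proof. by case: k => k kn; rewrite nth_map_enum. Qed.

Lemma order_stat_perm n (x : 'I_n -> R) :
  exists p : 'S_n,
    sort <=%R [seq x j | j <- enum 'I_n] = [seq x (p i) | i <- enum 'I_n].
Proof.
have /tuple_permP[p sp] : perm_eq (sort <=%R [tuple x j | j < n]) [tuple x j | j < n].
  by rewrite perm_sort.
exists p; rewrite [LHS]sp; apply: eq_map => i.
by rewrite tnth_mktuple.
Qed.

(** On each of the finitely many events that fix the order of the variables, an
    order statistic is one of the variables. *)
Lemma measurable_order_stat n (Z : 'I_n -> T0 -> R) (i : 'I_n) :
  (forall j, measurable_fun setT (Z j)) -> measurable_fun setT (order_stat Z i).
Proof.
move=> mZ _ A mA; rewrite setTI.
(* D p is the event on which the permutation p lists the values in order. *)
pose D (p : 'S_n) := \bigcap_(jk in [set jk : 'I_n * 'I_n | (jk.1 <= jk.2)%N])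
  [set o | Z (p jk.1) o <= Z (p jk.2) o].
have sortE p o : D p o ->
    sort <=%R [seq Z j o | j <- enum 'I_n] = [seq Z (p j) o | j <- enum 'I_n].
  move=> Dpo.
  have srt : sorted <=%R [seq Z (p j) o | j <- enum 'I_n].
    apply/(sortedP 0) => k; rewrite size_map size_enum_ord => kn.
    have k'n := ltnW kn; rewrite !nth_map_enum.
    exact: (Dpo (Ordinal k'n, Ordinal kn) (leqnSn k)).
  rewrite -[RHS]sort_le_id//; apply/perm_sort_leP.
  rewrite perm_sym; apply/(@tuple_permP _ _ _ [tuple Z j o | j < n]); exists p.
  by rewrite /=; apply: eq_map => j; rewrite tnth_mktuple.
have -> : order_stat Z i @^-1` A = \bigcup_(p in [set: 'S_n]) (D p `&` Z (p i) @^-1` A).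
  apply/seteqP; split => o /=.
    have [p sp] := order_stat_perm (fun j => Z j o).
    have Dpo : D p o.
      move=> [j k] /= jk.
      have := sort_le_sorted [seq Z j o | j <- enum 'I_n]; rewrite sp.
      move=> /(sorted_leq_nth le_trans le_refl 0)/(_ j k).
      by rewrite !inE size_map size_enum_ord !nth_map_ord; apply; rewrite ?ltn_ord.
    rewrite /order_stat (sortE p)// nth_map_ord => AZ.
    by exists p.
  move=> [p _ [Dpo AZ]].
  by rewrite /order_stat (sortE p)// nth_map_ord.
apply: fin_bigcup_measurable; first exact: finite_finset.
move=> p _; apply: measurableI.
  apply: fin_bigcap_measurable => [|jk _]; first exact: finite_finset.
  rewrite -[X in measurable X]setTI; exact: measurable_fun_le.
by rewrite -[X in measurable X]setTI; exact: mZ.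
Qed.

Lemma iid_uniform_perm n (Z : 'I_n -> {RV P >-> R}) (p : 'S_n) :
  iid_uniform01 Z -> iid_uniform01 (fun i => Z (p i)).
Proof.
move=> [indZ ZU]; split => [A mA|i A mA]; last exact: ZU.
have := indZ (fun i => A (p^-1%g i)) (fun i => mA _) => indA.
transitivity (P (\bigcap_i Z i @^-1` A (p^-1%g i))).
  congr (P _); apply/seteqP; split => w /= H i _ /=.
    by have := H (p^-1%g i) I; rewrite /= permKV.
  by have := H (p i) I; rewrite /= permK.
rewrite indA (reindex_inj (@perm_inj _ p))/=.
by apply: eq_bigr => i _; rewrite permK.
Qed.

Lemma iid_uniform_indep_pair n (Z : 'I_n -> {RV P >-> R}) (i j : 'I_n) (A B : set R) :
  iid_uniform01 Z -> i != j -> measurable A -> measurable B ->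
  P (Z i @^-1` A `&` Z j @^-1` B) = (P (Z i @^-1` A) * P (Z j @^-1` B))%E.
Proof.
move=> [indZ _] ij mA mB.
pose C k : set R := if k == i then A else if k == j then B else setT.
have mC k : measurable (C k) by rewrite /C; case: ifP => // _; case: ifP.
have := indZ C mC; rewrite (bigD1 i)//= (bigD1 j) 1?eq_sym//= big1 => [|k /andP[ki kj]].
  rewrite mule1 /C eqxx eq_sym (negbTE ij) eqxx => <-.
  congr (P _); apply/seteqP; split => w /=.
    by move=> [Aw Bw] k _ /=; case: eqP => [->//|_]; case: eqP => [->|].
  move=> H; split.
    by have := H i I; rewrite /= eqxx.
  by have := H j I; rewrite /= eq_sym (negbTE ij) eqxx.
by rewrite /C (negbTE ki) (negbTE kj) preimage_setT probability_setT.
Qed.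

(** The uniform law has no atoms, so Z j almost surely avoids the value of an
    independent Z i. *)
Lemma iid_uniform_ae_distinct n (Z : 'I_n -> {RV P >-> R}) :
  iid_uniform01 Z -> {ae P, forall o, injective (fun i => Z i o)}.
Proof.
move=> iidZ; have [_ ZU] := iidZ.
have H i j : i != j -> {ae P, forall o, Z i o != Z j o}.
  move=> ij.
  pose h (p : R * R) : R := (p.1 == p.2)%:R.
  have mh : measurable_fun setT h.
    by apply: measurable_bool_natr; exact: measurable_fun_eqr.
  have h1 p : `|h p| <= 1 by rewrite normr_bool_le1.
  have E0 : \int[P]_o h (Z i o, Z j o) = 0.
    rewrite (@indep_pair_Rintegral _ _ _ _ _ _ _ P (Z i) (Z j) h 1)//; last first.
      by move=> A B mA mB; exact: iid_uniform_indep_pair.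
    rewrite (@eq_Rintegral _ _ _ P setT (cst 0)) ?Rintegral_cst ?mul0r// => o _ /=.
    rewrite (@eq_Rintegral _ _ _ P setT (\1_(Z j @^-1` [set Z i o]))); last first.
      move=> v _; rewrite /h /= indicE; congr (nat_of_bool _)%:R; apply/idP/idP.
        by move/eqP => E; rewrite inE /= E.
      by rewrite inE /= => ->.
    have mS : measurable (Z j @^-1` [set Z i o]).
      by rewrite -[X in measurable X]setTI; exact: (measurable_funPT (Z j)).
    rewrite Rintegral_indic// [X in fine X = _](ZU j [set Z i o])//.
    by rewrite /uniform_prob integral_set1.
  have mS : measurable [set o | Z i o = Z j o].
    rewrite (_ : [set o | _] = (fun o => Z i o == Z j o) @^-1` [set true]).
      rewrite -[X in measurable X]setTI.
      exact: (@measurable_fun_eqr _ _ _ setT (Z i) (Z j)).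
    by apply/seteqP; split => o /= /eqP.
  exists [set o | Z i o = Z j o]; split => //; last first.
    by move=> o /= /negP; rewrite negbK => /eqP.
  apply/eqP; rewrite -[X in X == _]fineK ?fin_num_measure// eqe -E0.
  rewrite (@eq_Rintegral _ _ _ P setT (\1_[set o | Z i o = Z j o])); last first.
    move=> o _; rewrite /h /= indicE; congr (nat_of_bool _)%:R; apply/idP/idP.
      by move/eqP => E; rewrite inE.
    by rewrite inE /= => ->.
  by rewrite Rintegral_indic.
have : {ae P, forall o, forall i j, i != j -> Z i o != Z j o}.
  apply: filter_forall => i; apply: filter_forall => j.
  have [->|ij] := eqVneq i j; first by apply: filterE => o.
  by apply: filterS (H i j ij) => o.
apply: filterS => o oP i j /eqP; apply: contraPeq => /oP.
by move/negP.
Qed.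

Lemma uniform_ae_gt0 (Z : {RV P >-> R}) :
  (forall A : set R, measurable A ->
    distribution P Z A = uniform_prob (@ltr01 R) A) ->
  {ae P, forall o, 0 < Z o}.
Proof.
move=> ZU.
exists (Z @^-1` `]-oo, 0]); split.
- by rewrite -[X in measurable X]setTI; exact: (measurable_funPT Z).
- rewrite [LHS](ZU `]-oo, 0]%classic)// /uniform_prob integral_uniform_pdf.
  apply: (@integral_Sset1 _ _ _ 0) => x [/=]; rewrite !in_itv/= => x0 /andP[x0' _].
  by apply/eqP; rewrite eq_le x0.
- by move=> o /= /negP; rewrite in_itv/= leNgt.
Qed.

Lemma order_stat_homo n (Z : 'I_n -> T0 -> R) o i j :
  (i <= j < n)%N -> order_stat Z i o <= order_stat Z j o.
Proof.
move=> /andP[ij jn]; rewrite /order_stat.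
apply: (sorted_leq_nth le_trans le_refl 0 (sort_le_sorted _)) => //.
  by rewrite inE size_sort size_map size_enum_ord (leq_ltn_trans ij).
by rewrite inE size_sort size_map size_enum_ord.
Qed.

Lemma order_stat_ae01 n (Z : 'I_n -> {RV P >-> R}) :
  iid_uniform01 Z ->
  {ae P, forall o, forall i, (i < n)%N -> order_stat Z i o \in `[0, 1]}.
Proof.
move=> [_ ZU].
have : {ae P, forall o, forall i, Z i o \in `[0, 1]}.
  apply: filter_forall => i.
  exists (Z i @^-1` (~` `[0, 1]%classic)); split => //.
    rewrite -[X in measurable X]setTI; apply: (measurable_funPT (Z i)) => //.
    exact: measurableC.
  have mC : measurable (~` `[0, 1]%classic : set R) by exact: measurableC.
  by rewrite [LHS](ZU i _ mC) /uniform_prob integral_uniform_pdf setICl integral_set0.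
apply: filterS => o Z01 i ltin.
have [p sp] := order_stat_perm (fun j => Z j o).
by rewrite /order_stat sp nth_map_enum.
Qed.

End OrderStatistics.

(** * Signature coefficients as expectations *)

Section OrderStatExpectation.
Context (R : realType) (I : Type) (g : I -> R -> R).
Hypothesis mg : forall i, measurable_fun setT (g i).
Hypothesis g1 : forall i t, `|g i t| <= 1.
Context (d0 : measure_display) (T0 : measurableType d0) (P : probability T0 R).

Lemma normr_prod_le1 n (w : n.-tuple I) (x : 'I_n -> R) :
  `|\prod_(i < n) g (tnth w i) (x i)| <= 1.
Proof. by rewrite normr_prod prodr_ile1// => i _; rewrite normr_ge0 g1. Qed.

Lemma measurable_prod_order_stat n (w : n.-tuple I) (Z : 'I_n -> {RV P >-> R}) :
  measurable_fun setT (fun o => \prod_(i < n) g (tnth w i) (order_stat Z i o)).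
Proof.
apply: measurable_prod => i _; apply: measurableT_comp => //.
by apply: measurable_order_stat.
Qed.

(** Almost surely exactly one of the n! orderings of the variables occurs, and by
    exchangeability each of them contributes the same simplex integral. *)
Lemma expectation_order_stat n (w : n.-tuple I) (Z : 'I_n -> {RV P >-> R}) :
  iid_uniform01 Z ->
  \int[P]_o \prod_(i < n) g (tnth w i) (order_stat Z i o) =
  n`!%:R * simplex_integral g w 0.
Proof.
move=> iidZ.
have mt (p : 'S_n) : measurable_fun setT
    (fun o => increasing_prod g w 0 [tuple Z (p i) o | i < n]).
  have mY : measurable_fun setT (fun o => [tuple Z (p i) o | i < n]).
    exact: measurable_mktuple.
  exact: (measurableT_comp (measurable_increasing_prod mg w)
    (measurable_fun_pair (measurable_cst (0 : R)) mY)).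
transitivity (\int[P]_o
    \sum_(p : 'S_n) increasing_prod g w 0 [tuple Z (p i) o | i < n]).
  rewrite /Rintegral; congr fine; apply: ae_eq_integral => //.
  - by apply/measurable_EFinP; apply: measurable_prod_order_stat.
  - by apply/measurable_EFinP; apply: measurable_sum.
  - have [_ ZU] := iidZ.
    have Z0 : {ae P, forall o, forall i, 0 < Z i o}.
      by apply: filter_forall => i; apply: uniform_ae_gt0; exact: ZU.
    have Zinj := iid_uniform_ae_distinct iidZ.
    apply: filterS2 Z0 Zinj => o Z0 Zinj _; congr EFin.
    by rewrite -(sum_perm_increasing_prod g w Zinj Z0).
rewrite Rintegral_sum; last first.
  move=> p; apply: (@bounded_integrable _ _ _ P _ 1) => // o.
  exact: increasing_prod_le1.
under eq_bigr => p _ do rewrite (expectation_increasing_prod mg g1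
  (iid_uniform_perm p iidZ) (size_tuple w))//.
by rewrite sumr_const card_Sn mulr_natl.
Qed.

Lemma independent_order_stat n (U V : 'I_n -> {RV P >-> R})
    (a b : n.-tuple R -> R) :
  independent_families P (fun i : 'I_n => order_stat U i)
    (fun i : 'I_n => order_stat V i) ->
  measurable_fun setT a -> measurable_fun setT b ->
  (forall t, `|a t| <= 1) -> (forall t, `|b t| <= 1) ->
  \int[P]_o (a [tuple order_stat U i o | i < n] * b [tuple order_stat V i o | i < n]) =
  (\int[P]_o a [tuple order_stat U i o | i < n]) *
  (\int[P]_o b [tuple order_stat V i o | i < n]).
Proof.
move=> ind ma mb a1 b1.
pose oU o := [tuple order_stat U i o | i < n].
pose oV o := [tuple order_stat V i o | i < n].
have mo (Z : 'I_n -> {RV P >-> R}) :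
    measurable_fun setT (fun o => [tuple order_stat Z i o | i < n]).
  by apply: measurable_mktuple => i; exact: measurable_order_stat.
have oE (Z : 'I_n -> {RV P >-> R}) (A : 'I_n -> set R) :
    (fun o => [tuple order_stat Z i o | i < n]) @^-1` rectangle A =
    \bigcap_(i in [set: 'I_n]) order_stat Z i @^-1` A i.
  exact: preimage_rectangle.
(* Rectangles are replaced by arbitrary measurable sets, one side at a time. *)
have ind1 A B : (forall i, measurable (A i)) -> measurable B ->
    P (oU @^-1` rectangle A `&` oV @^-1` B) =
    (P (oU @^-1` rectangle A) * P (oV @^-1` B))%E.
  move=> mA; apply: indep_tuple; [|exact: mo|].
    rewrite -[X in measurable X]setTI; apply: mo => //.
    exact: measurable_rectangle.
  by move=> C mC; rewrite !oE; exact: ind.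
have ind2 A B : measurable A -> measurable B ->
    P (oU @^-1` A `&` oV @^-1` B) = (P (oU @^-1` A) * P (oV @^-1` B))%E.
  move=> mA mB; rewrite setIC muleC; move: A mA; apply: indep_tuple; [|exact: mo|].
    by rewrite -[X in measurable X]setTI; apply: mo.
  by move=> C mC; rewrite setIC muleC ind1.
pose h (p : n.-tuple R * n.-tuple R) := a p.1 * b p.2.
have mh : measurable_fun setT h.
  apply: measurable_funM; first exact: (measurableT_comp ma).
  exact: (measurableT_comp mb).
transitivity (\int[P]_o h (oU o, oV o)); first by [].
rewrite (@indep_pair_Rintegral _ _ _ _ _ _ _ P oU oV h 1)//;
  [|exact: mo|exact: mo|]; last first.
  by move=> p; rewrite normrM mulr_ile1.
rewrite -RintegralZr//; last first.
  apply: (@bounded_integrable _ _ _ P _ 1) => //.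
  exact: (measurableT_comp ma (mo U)).
apply: eq_Rintegral => o _; rewrite /h/= RintegralZl//.
apply: (@bounded_integrable _ _ _ P _ 1) => //.
exact: (measurableT_comp mb (mo V)).
Qed.

End OrderStatExpectation.

(** Expanding the product of sums gives one term per word, whose expectation
    factorizes by independence into two equal simplex integrals. *)
Lemma expectation_prod_inner (R : realType) (d : nat) (g : 'I_d -> R -> R)
    (d0 : measure_display) (T0 : measurableType d0) (P : probability T0 R)
    (n : nat) (U V : 'I_n -> {RV P >-> R}) :
  (forall j, measurable_fun setT (g j)) -> (forall j t, `|g j t| <= 1) ->
  iid_uniform01 U -> iid_uniform01 V ->
  independent_families P (fun i : 'I_n => order_stat U i)
    (fun i : 'I_n => order_stat V i) ->
  \int[P]_o \prod_(i < n)
    (\sum_(j < d) g j (order_stat U i o) * g j (order_stat V i o)) =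
  n`!%:R ^+ 2 * \sum_(w : n.-tuple 'I_d) simplex_integral g w 0 ^+ 2.
Proof.
move=> mg g1 iidU iidV ind.
pose prodg (w : n.-tuple 'I_d) (t : n.-tuple R) :=
  \prod_(i < n) g (tnth w i) (tnth t i).
have mprodg w : measurable_fun setT (prodg w).
  apply: measurable_prod => i _; apply: measurableT_comp => //.
  exact: measurable_tnth.
have prodg1 w t : `|prodg w t| <= 1 by exact: normr_prod_le1.
have prodgE w (Z : 'I_n -> {RV P >-> R}) o :
    prodg w [tuple order_stat Z i o | i < n] =
    \prod_(i < n) g (tnth w i) (order_stat Z i o).
  by apply: eq_bigr => i _; rewrite tnth_mktuple.
transitivity (\int[P]_o \sum_(w : n.-tuple 'I_d)
    (prodg w [tuple order_stat U i o | i < n] *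
     prodg w [tuple order_stat V i o | i < n])).
  apply: eq_Rintegral => o _.
  pose u i : 'rV[R]_d := \row_j g j (order_stat U i o).
  pose v i : 'rV[R]_d := \row_j g j (order_stat V i o).
  transitivity (\prod_(i < n) \sum_(j < d) u i 0 j * v i 0 j).
    by apply: eq_bigr => i _; apply: eq_bigr => j _; rewrite !mxE.
  rewrite -hs_inner_pure; apply: eq_bigr => w _; rewrite !ffunE !prodgE.
  by congr (_ * _); apply: eq_bigr => i _; rewrite mxE.
rewrite Rintegral_sum; last first.
  move=> w; apply: (@bounded_integrable _ _ _ P _ 1).
    apply: measurable_funM.
      by under eq_fun do rewrite prodgE; exact: measurable_prod_order_stat.
    by under eq_fun do rewrite prodgE; exact: measurable_prod_order_stat.
  by move=> o; rewrite normrM mulr_ile1.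
rewrite mulr_sumr; apply: eq_bigr => w _.
rewrite (independent_order_stat ind (mprodg w) (mprodg w))//.
under eq_Rintegral do rewrite prodgE.
under [X in _ * X]eq_Rintegral do rewrite prodgE.
rewrite (expectation_order_stat mg g1 w iidU).
by rewrite (expectation_order_stat mg g1 w iidV) -expr2 exprMn.
Qed.

(** * Optimal transport between empirical measures *)

Section MongeDuality.
Context (R : realType).
Implicit Types (x y : nat -> R) (c : R -> R -> R).

Definition monge c := forall x x' y y' : R, x <= x' -> y <= y' ->
  c x y + c x' y' <= c x y' + c x' y.

(** Induction on k: the defect of the product of two averages is the covariance of
    the similarly ordered pairs (X, Y) and (X ^+ k, Y ^+ k). *)
Lemma expr_convex (k : nat) (l X Y : R) : 0 <= l <= 1 -> 0 <= X -> 0 <= Y ->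
  (l * X + (1 - l) * Y) ^+ k <= l * X ^+ k + (1 - l) * Y ^+ k.
Proof.
move=> /andP[l0 l1] X0 Y0; have l1' : 0 <= 1 - l by rewrite subr_ge0.
elim: k => [|k IH]; first by rewrite !expr0 !mulr1 addrC subrK.
have m0 : 0 <= l * X + (1 - l) * Y by rewrite addr_ge0 ?mulr_ge0.
rewrite exprS (le_trans (ler_wpM2l m0 IH))// !exprS -subr_ge0.
have -> : l * (X * X ^+ k) + (1 - l) * (Y * Y ^+ k) -
  (l * X + (1 - l) * Y) * (l * X ^+ k + (1 - l) * Y ^+ k) =
  l * (1 - l) * ((X - Y) * (X ^+ k - Y ^+ k)) by ring.
(* The two powers are ordered as X and Y are. *)
apply: mulr_ge0; first exact: mulr_ge0.
have [XY|/ltW YX] := leP X Y.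
  by apply: mulr_le0; rewrite subr_le0// lerXn2r.
by rewrite mulr_ge0// subr_ge0// lerXn2r.
Qed.

Lemma expr_even_convex (k : nat) (l a b : R) : 0 <= l <= 1 ->
  (l * a + (1 - l) * b) ^+ (2 * k) <= l * a ^+ (2 * k) + (1 - l) * b ^+ (2 * k).
Proof.
move=> l01; rewrite !exprM.
apply: (le_trans _ (expr_convex k l01 (sqr_ge0 a) (sqr_ge0 b))).
case/andP: l01 => l0; rewrite -subr_ge0 => l1.
rewrite lerXn2r ?nnegrE ?sqr_ge0//.
  by apply: addr_ge0; apply: mulr_ge0 => //; exact: sqr_ge0.
rewrite -subr_ge0 (_ : _ - _ = l * (1 - l) * (a - b) ^+ 2); last by ring.
exact: mulr_ge0 (mulr_ge0 l0 l1) (sqr_ge0 _).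
Qed.

Lemma monge_expr_even (k : nat) : monge (fun a b => (a - b) ^+ (2 * k)).
Proof.
move=> x x' y y' xx' yy'.
have [xE|xNE] := eqVneq (x' - x + (y' - y)) 0.
  have -> : x' = x by lra.
  by rewrite addrC.
have D0 : 0 < x' - x + (y' - y) by rewrite lt_neqAle eq_sym xNE addr_ge0// subr_ge0.
(* x - y and x' - y' are convex combinations of x - y' and x' - y, with the
   weights exchanged. *)
pose l := (x' - x) / (x' - x + (y' - y)).
have l01 : 0 <= l <= 1.
  rewrite /l divr_ge0 ?subr_ge0 ?(ltW D0)//=.
  by rewrite ler_pdivrMr// mul1r lerDl subr_ge0.
have l01' : 0 <= 1 - l <= 1 by lra.
have E1 : x - y = l * (x - y') + (1 - l) * (x' - y).
  by rewrite /l; field.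
have E2 : x' - y' = (1 - l) * (x - y') + (1 - (1 - l)) * (x' - y).
  by rewrite /l; field.
have H1 := expr_even_convex k (x - y') (x' - y) l01.
have H2 := expr_even_convex k (x - y') (x' - y) l01'.
rewrite -E1 in H1; rewrite -E2 in H2.
by have := lerD H1 H2; congr (_ <= _); ring.
Qed.

(** The Kantorovich potential of the monotone matching, accumulated while climbing
    from x 0 to x i along the matched pairs. *)
Definition potential c x y (i : nat) : R :=
  \sum_(k < i) (c (x k.+1) (y k) - c (x k) (y k)).

(** Dual feasibility. Going from x k to x k.+1 changes the cost against y k by at
    most its change against y j if j <= k, and by at least that if k <= j: this is
    the Monge property. *)
Lemma potential_le c x y n : monge c ->
  (forall i j, (i <= j < n)%N -> x i <= x j) ->
  (forall i j, (i <= j < n)%N -> y i <= y j) ->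
  forall i j, (i < n)%N -> (j < n)%N ->
  potential c x y i + (c (x j) (y j) - potential c x y j) <= c (x i) (y j).
Proof.
move=> mc xnd ynd i j ltin ltjn.
(* As a function of i, the slack f is maximal at i = j. *)
pose f i := potential c x y i - c (x i) (y j).
have fS k : f k.+1 - f k =
    c (x k.+1) (y k) - c (x k) (y k) - (c (x k.+1) (y j) - c (x k) (y j)).
  by rewrite /f /potential big_ord_recr /=; ring.
suff : f i <= f j by rewrite /f; lra.
have [ij|/ltnW ji] := leqP i j.
  have H m : (i + m <= j)%N -> f i <= f (i + m)%N.
    elim: m => [|m IH]; first by rewrite addn0.
    rewrite addnS => imj; apply: (le_trans (IH (ltnW imj))).
    rewrite -subr_ge0 fS.
    have := mc (x (i + m)%N) (x (i + m).+1) (y (i + m)%N) (y j).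
    rewrite xnd ?leqnSn ?(leq_ltn_trans imj)// ynd ?(ltnW imj)// => /(_ isT isT).
    lra.
  by have := H (j - i)%N; rewrite subnKC//; apply.
have H m : (j + m < n)%N -> f (j + m)%N <= f j.
  elim: m => [|m IH]; first by rewrite addn0.
  rewrite addnS => jmn; apply: (le_trans _ (IH (ltnW jmn))).
  rewrite -subr_ge0 -opprB fS.
  have := mc (x (j + m)%N) (x (j + m).+1) (y j) (y (j + m)%N).
  rewrite xnd ?leqnSn ?jmn// ynd ?leq_addr ?(ltnW jmn)// => /(_ isT isT).
  lra.
by have := H (i - j)%N; rewrite subnKC//; apply.
Qed.

End MongeDuality.

Section Coupling.
Context (R : realType).

Lemma empirical_measureE (n : nat) (x : nat -> R) (A : set R) :
  empirical_measure n x A = (n%:R^-1 * \sum_(k < n) (x k \in A)%:R)%:E.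
Proof.
rewrite /empirical_measure /mscale /= /msum EFinM -sumEFin; congr (_ * _)%E.
Qed.

(** The points x i may repeat: only the first index at which a value occurs is
    kept, so that each value is counted once. *)
Definition step_fun (n : nat) (x a : nat -> R) (t : R) : R :=
  \sum_(i < n | index (x i) (mkseq x n) == i) a i * (t == x i)%:R.

Lemma step_funE (n : nat) (x a : nat -> R) (k : nat) : (k < n)%N ->
  step_fun n x a (x k) = a (index (x k) (mkseq x n)).
Proof.
move=> kn; set i := index _ _.
have xk : x k \in mkseq x n by apply/mapP; exists k; rewrite ?mem_iota.
have ltin : (i < n)%N by rewrite -[X in (_ < X)%N](size_mkseq x) index_mem.
have xi : x i = x k by rewrite -[RHS](nth_index 0 xk) nth_mkseq.
rewrite /step_fun (bigD1 (Ordinal ltin)) /=; last by rewrite xi.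
rewrite xi eqxx mulr1 big1 ?addr0// => j /andP[/eqP jE ji].
case: eqP => [E|]; last by rewrite mulr0.
by case/eqP: ji; apply: val_inj; rewrite /= -jE -E.
Qed.

Lemma measurable_step_fun n (x a : nat -> R) : measurable_fun setT (step_fun n x a).
Proof.
rewrite /step_fun; under eq_fun do rewrite big_mkcond.
apply: measurable_sum => i; case: (index _ _ == _); last exact: measurable_cst.
apply: measurable_funM => //.
by apply: measurable_bool_natr; exact: measurable_fun_eqr.
Qed.

Lemma step_fun_bounded n (x a : nat -> R) t :
  `|step_fun n x a t| <= \sum_(i < n) `|a i|.
Proof.
apply: (le_trans (ler_norm_sum _ _ _)).
rewrite big_mkcond; apply: ler_sum => i _; case: ifP => // _.
by rewrite normrM ler_piMr ?normr_bool_le1.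
Qed.

Lemma Rintegral_step_fun (d0 : measure_display) (T0 : measurableType d0)
    (P : probability T0 R) (X : T0 -> R) n (x a : nat -> R) :
  measurable_fun setT X ->
  (forall A, measurable A -> P (X @^-1` A) = empirical_measure n x A) ->
  \int[P]_o step_fun n x a (X o) = n%:R^-1 * \sum_(k < n) step_fun n x a (x k).
Proof.
move=> mX PX; rewrite /step_fun.
under eq_Rintegral do rewrite big_mkcond.
rewrite Rintegral_sum; last first.
  move=> i; apply: (@bounded_integrable _ _ _ P _ `|a i|).
    case: (index _ _ == _); last exact: measurable_cst.
    apply: measurable_funM => //.
    by apply: measurable_bool_natr; exact: measurable_fun_eqr.
  move=> o; case: ifP => // _; last by rewrite normr0.
  by rewrite normrM ler_piMr ?normr_bool_le1.
rewrite exchange_big [X in _ * X]big_mkcond mulr_sumr; apply: eq_bigr => i _.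
case: ifP => // _; last by rewrite Rintegral_cst// mul0r mulr0.
rewrite -mulr_sumr mulrCA.
have mS : measurable (X @^-1` [set x i]).
  by rewrite -[Y in measurable Y]setTI; exact: mX.
rewrite (@eq_Rintegral _ _ _ P setT (fun o => a i * \1_(X @^-1` [set x i]) o));
  last first.
  move=> o _; congr (_ * _); rewrite indicE; congr (nat_of_bool _)%:R; apply/idP/idP.
    by move/eqP => E; rewrite inE.
  by rewrite inE /= => ->.
rewrite RintegralZl//; last first.
  apply: (@bounded_integrable _ _ _ P _ 1) => // o.
  by rewrite indicE normr_bool_le1.
congr (_ * _); rewrite Rintegral_indic// [X in fine X = _](PX [set x i])//.
rewrite empirical_measureE/=; congr (_ * _); apply: eq_bigr => k _.
by congr (nat_of_bool _)%:R; apply/idP/idP; rewrite inE => /eqP.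
Qed.

(** Kantorovich duality: the potentials sum to at most c (x i) (y j), with equality
    for i = j, and their integrals depend on the marginals only. Hence no coupling
    beats the monotone matching. *)
Lemma coupling_cost_ge (c : R -> R -> R) (x y : nat -> R) (n : nat)
    (pi : probability (R * R)%type R) :
  monge c -> (forall a b, 0 <= c a b) ->
  measurable_fun setT (fun z : R * R => c z.1 z.2) ->
  (forall i j, (i <= j < n)%N -> x i <= x j) ->
  (forall i j, (i <= j < n)%N -> y i <= y j) ->
  is_coupling (empirical_measure n x) (empirical_measure n y) pi ->
  ((n%:R^-1 * \sum_(i < n) c (x i) (y i))%:E <= \int[pi]_z (c z.1 z.2)%:E)%E.
Proof.
move=> mc c0 mcm xnd ynd cpl.
pose phi := potential c x y.
pose psi i := c (x i) (y i) - phi i.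
have dual i j : (i < n)%N -> (j < n)%N -> phi i + psi j <= c (x i) (y j).
  exact: (potential_le mc xnd ynd).
pose Phi := step_fun n x phi; pose Psi := step_fun n y psi.
have idx (u : nat -> R) k : (k < n)%N ->
    (index (u k) (mkseq u n) < n)%N /\ u (index (u k) (mkseq u n)) = u k.
  move=> kn; have uk : u k \in mkseq u n.
    by apply/mapP; exists k; rewrite ?mem_iota.
  have ltin : (index (u k) (mkseq u n) < n)%N.
    by rewrite -[X in (_ < X)%N](size_mkseq u n) index_mem.
  by split => //; rewrite -[RHS](nth_index 0 uk) nth_mkseq.
(* Equal points have equal potentials: each of two tied indices satisfies the
   dual constraint of the other, with equality on the diagonal. *)
have PhiE k : (k < n)%N -> Phi (x k) = phi k.
  move=> kn; rewrite /Phi step_funE//; set i := index _ _.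
  have [ltin xi] := idx x k kn; rewrite -/i in ltin xi.
  have := dual i k ltin kn; have := dual k i kn ltin; rewrite /psi xi; lra.
have PsiE k : (k < n)%N -> Psi (y k) = psi k.
  move=> kn; rewrite /Psi step_funE//; set i := index _ _.
  have [ltin yi] := idx y k kn; rewrite -/i in ltin yi.
  have := dual i k ltin kn; have := dual k i kn ltin; rewrite /psi yi; lra.
pose f (z : R * R) := Phi z.1 + Psi z.2.
have mPhi : measurable_fun setT (fun z : R * R => Phi z.1).
  by apply: (measurableT_comp (measurable_step_fun _ _ _)).
have mPsi : measurable_fun setT (fun z : R * R => Psi z.2).
  by apply: (measurableT_comp (measurable_step_fun _ _ _)).
have fE : \int[pi]_z f z = n%:R^-1 * \sum_(i < n) c (x i) (y i).
  rewrite /f RintegralD//; last 2 first.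
  - apply: (@bounded_integrable _ _ _ pi _ (\sum_(i < n) `|phi i|)) => // z.
    exact: step_fun_bounded.
  - apply: (@bounded_integrable _ _ _ pi _ (\sum_(i < n) `|psi i|)) => // z.
    exact: step_fun_bounded.
  rewrite (@Rintegral_step_fun _ _ pi fst n x phi)//; last first.
    move=> A mA; rewrite -(cpl A mA).1; congr (pi _).
    by apply/seteqP; split => z //= [].
  rewrite (@Rintegral_step_fun _ _ pi snd n y psi)//; last first.
    move=> A mA; rewrite -(cpl A mA).2; congr (pi _).
    by apply/seteqP; split => z //= [].
  rewrite -mulrDr -big_split/=; congr (_ * _); apply: eq_bigr => i _.
  rewrite -/Phi -/Psi PhiE// PsiE// /psi; ring.
pose M := \sum_(i < n) `|phi i| + \sum_(i < n) `|psi i|.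
have mf : measurable_fun setT f by exact: measurable_funD.
have fM z : `|f z| <= M.
  apply: (le_trans (ler_normD _ _)); apply: lerD; exact: step_fun_bounded.
have fi : pi.-integrable setT (EFin \o f) by exact: (@bounded_integrable _ _ _ pi f M).
have mf0 : measurable_fun setT (fun z => Num.max (f z) 0) by exact: measurable_maxr.
(* The marginals put all their mass on the points x i and y j. *)
have f_ae : {ae pi, forall z, f z <= c z.1 z.2}.
  have mS (u : nat -> R) : measurable (~` [set t : R | t \in mkseq u n]).
    apply: measurableC; rewrite (_ : [set t | _] = \bigcup_(k in `I_n) [set u k]).
      by apply: fin_bigcup_measurable => //; exact: finite_II.
    apply/seteqP; split => t /=.
      by move/mapP => [k]; rewrite mem_iota add0n => /= kn ->; exists k.
    by move=> [k /= kn ->]; apply/mapP; exists k; rewrite ?mem_iota.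
  have S0 (u : nat -> R) :
      empirical_measure n u (~` [set t : R | t \in mkseq u n]) = 0%E.
    rewrite empirical_measureE big1 ?mulr0// => k _.
    rewrite memNset//= => H; apply: H.
    by apply/mapP; exists (k : nat); rewrite ?mem_iota /=.
  have ae1 : {ae pi, forall z, z.1 \in mkseq x n}.
    exists ((~` [set t : R | t \in mkseq x n]) `*` setT); split => //.
    - exact: measurableX.
    - by rewrite (cpl _ (mS x)).1 S0.
  have ae2 : {ae pi, forall z, z.2 \in mkseq y n}.
    exists (setT `*` (~` [set t : R | t \in mkseq y n])); split => //.
    - exact: measurableX.
    - by rewrite (cpl _ (mS y)).2 S0.
  apply: filterS2 ae1 ae2 => -[z1 z2] /= /mapP[i] + -> /mapP[j] + ->.
  rewrite !mem_iota !add0n /= => ltin ltjn.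
  by rewrite /f/= PhiE// PsiE//; exact: dual.
rewrite -fE /Rintegral fineK; last exact: integrable_fin_num.
apply: (@le_trans _ _ (\int[pi]_z (Num.max (f z) 0)%:E)%E).
  apply: le_integral => //.
  - apply: (@bounded_integrable _ _ _ pi _ M) => // z.
    by case: (leP (f z) 0) => _ //; rewrite normr0 (le_trans _ (fM z)).
  - by move=> z _; rewrite lee_fin le_max lexx.
apply: ae_ge0_le_integral => //.
- by move=> z _; rewrite lee_fin le_max lexx orbT.
- exact/measurable_EFinP.
- by move=> z _; rewrite lee_fin.
- exact/measurable_EFinP.
- by apply: filterS f_ae => z fz _; rewrite lee_fin ge_max fz c0.
Qed.

End Coupling.

(** * The logarithmic series and the Wasserstein exponent *)

Section LogSeries.
Context (R : realType).

Definition log_sum (N : nat) (t : R) : R := \sum_(k < N) t ^+ k.+1 / k.+1%:R.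

Lemma is_derive_log_sum (N : nat) (t : R) :
  is_derive t 1 (log_sum N) (\sum_(k < N) t ^+ k).
Proof.
elim: N => [|N IH].
  rewrite big_ord0; have -> : log_sum 0 = cst 0; last exact: is_derive_cst.
  by apply/funext => u; rewrite /log_sum big_ord0.
have -> : log_sum N.+1 = log_sum N + (N.+1%:R^-1 \*: (@id R : R -> R) ^+ N.+1).
  apply/funext => u; rewrite /log_sum big_ord_recr /=; congr (_ + _).
  by rewrite mulrC /= exprfctE.
rewrite big_ord_recr; apply: is_deriveD.
have H := is_deriveZ N.+1%:R^-1 (is_deriveX N.+1 (is_derive_id t (1 : R))).
apply: is_derive_eq H _.
by rewrite /GRing.scale/= mulr1 mulrA mulVf ?mul1r// pnatr_eq0.
Qed.

(** The remainder bound is uniform in y, so that it survives the average over the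
    sample and vanishes as N grows. *)
Lemma log_sum_ge (N : nat) (y : R) : 0 <= y <= 2^-1 ->
  - ln (1 - y) - 2 ^- N <= log_sum N y.
Proof.
move=> /andP[y0 y2].
have [->|yN0] := eqVneq y 0.
  rewrite subr0 ln1 oppr0 sub0r /log_sum big1 ?oppr_le0 ?invr_ge0 ?exprn_ge0//.
  by move=> k _; rewrite expr0n mul0r.
have y_gt0 : 0 < y by rewrite lt_neqAle eq_sym yN0.
(* The derivative of h is - t ^ N / (1 - t), which is at least - 2 ^ - N / y on
   [0, y]. *)
pose h t : R := ln (1 - t) + log_sum N t.
pose dh t : R := - (1 - t)^-1 + \sum_(k < N) t ^+ k.
have dhP (t : R) : t < 1 -> is_derive t 1 h (dh t).
  move=> t1; apply: is_deriveD; last exact: is_derive_log_sum.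
  have H : is_derive (1 - t) 1 (@ln R) (1 - t)^-1.
    by apply: is_derive1_ln; rewrite subr_gt0.
  have H2 : is_derive t 1 (fun u : R => 1 - u) (-1).
    apply: is_derive_eq (is_deriveB (is_derive_cst (1 : R) t (1 : R))
      (is_derive_id t (1 : R))) _.
    by rewrite sub0r.
  have := @is_derive1_comp _ (@ln R) (fun u : R => 1 - u) t _ _ H H2.
  by rewrite mulrN1.
have lt1 (t : R) : t <= y -> t < 1.
  move=> ty; apply: (le_lt_trans ty); apply: (le_lt_trans y2).
  by rewrite invf_lt1// ltr1n.
have cts : {within `[0, y], continuous h}.
  apply: continuous_in_subspaceT => t; rewrite inE/= in_itv/= => /andP[_ ty].
  apply: differentiable_continuous; apply/derivable1_diffP.
  by have [] := dhP _ (lt1 _ ty).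
have dhP' (t : R) : t \in `]0, y[ -> is_derive t 1 h (dh t).
  by rewrite in_itv/= => /andP[_ /ltW ty]; apply: dhP; exact: lt1.
have [c] := MVT y_gt0 dhP' cts.
rewrite in_itv/= => /andP[c0 cy].
rewrite {1 2}/h subr0 ln1 /log_sum [X in _ - (0 + X)]big1; last first.
  by move=> k _; rewrite expr0n mul0r.
rewrite -/(log_sum N y) addr0 !subr0 => E.
suff : - (2 ^- N) <= dh c * y by rewrite -E; lra.
have c1 : 0 < 1 - c by rewrite subr_gt0; apply: lt1; exact: ltW.
have -> : dh c = - (c ^+ N / (1 - c)).
  rewrite /dh; set S := \sum_(k < N) _.
  have SE : (1 - c) * S = 1 - c ^+ N.
    by have := subrX1 c N; rewrite -/S; lra.
  have -> : S = (1 - c) * S / (1 - c) by rewrite mulrAC divff ?mul1r// gt_eqF.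
  by rewrite SE; field; rewrite gt_eqF.
rewrite mulNr lerN2 mulrAC -mulrA -[leRHS]mulr1 ler_pM//.
- by rewrite exprn_ge0// ltW.
- by rewrite mulr_ge0// invr_ge0 ltW.
- rewrite -exprVn lerXn2r// ?nnegrE ?invr_ge0// ltW//.
  exact: lt_le_trans cy y2.
- by rewrite ler_pdivrMr// mul1r; lra.
Qed.

End LogSeries.

Section WassersteinBound.
Context (R : realType).

Lemma poweR_natE (e : \bar R) (k : nat) : (0 < k)%N -> (0 <= e)%E ->
  (e `^ k%:R)%E = (e ^+ k)%E.
Proof.
case: k => // k _; case: e => [r|_|//].
  by rewrite lee_fin /= => r0; rewrite powR_mulrn// EFin_expe.
rewrite poweRyr ?pnatr_eq0//; elim: k => [//|k IH].
by rewrite expeS -IH mulyy.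
Qed.

Lemma wasserstein_expe (k : nat) (mu nu : {measure set R -> \bar R}) : (0 < k)%N ->
  (wasserstein (2 * k)%N%:R mu nu ^+ (2 * k)%N)%E =
  ereal_inf [set (\int[pi]_z (`|z.1 - z.2| `^ (2 * k)%N%:R)%:E)%E |
                     pi in [set pi : probability (R * R)%type R |
                             is_coupling mu nu pi]].
Proof.
move=> k0; have k20 : (0 < 2 * k)%N by rewrite muln_gt0.
rewrite /wasserstein -poweR_natE ?poweR_ge0// -poweRrM mulVf ?poweRe1//.
  apply: le_ereal_inf_tmp => _ [pi _ <-]; apply: integral_ge0 => z _.
  by rewrite lee_fin powR_ge0.
by rewrite pnatr_eq0 -lt0n.
Qed.

Lemma wasserstein_even_ge (k n : nat) (x y : nat -> R) : (0 < k)%N ->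
  (forall i j, (i <= j < n)%N -> x i <= x j) ->
  (forall i j, (i <= j < n)%N -> y i <= y j) ->
  ((n%:R^-1 * \sum_(i < n) (x i - y i) ^+ (2 * k))%:E <=
   wasserstein (2 * k)%N%:R (empirical_measure n x) (empirical_measure n y)
     ^+ (2 * k)%N)%E.
Proof.
move=> k0 xnd ynd; rewrite wasserstein_expe//.
apply: le_ereal_inf_tmp => _ [pi cpl <-].
pose c (a b : R) := (a - b) ^+ (2 * k).
have cE (z : R * R) : `|z.1 - z.2| `^ (2 * k)%N%:R = c z.1 z.2.
  by rewrite powR_mulrn// /c !exprM real_normK// num_real.
under eq_integral do rewrite cE.
apply: coupling_cost_ge cpl => //.
- exact: monge_expr_even.
- by move=> a b; rewrite /c exprM exprn_ge0// sqr_ge0.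
- by apply: measurable_funX; exact: measurable_funB.
Qed.

(** At t = (x i - y i) ^+ 2 / 2 the series of - ln (1 - t) has the general term
    (x i - y i) ^+ (2 * k) / (k * 2 ^+ k), whose average over i is at most the
    Wasserstein cost. *)
Lemma exp_exponent_le (n : nat) (x y : nat -> R) : (0 < n)%N ->
  (forall i j, (i <= j < n)%N -> x i <= x j) ->
  (forall i j, (i <= j < n)%N -> y i <= y j) ->
  (forall i, (i < n)%N -> `|x i - y i| < 1) ->
  fine (expeR (- (n%:R%:E * \sum_(1 <= k <oo) ((k%:R * 2 ^+ k)^-1)%:E *
       wasserstein (2 * k)%N%:R (empirical_measure n x) (empirical_measure n y)
         ^+ (2 * k)%N))%E)
  <= \prod_(i < n) (1 - (x i - y i) ^+ 2 / 2).
Proof.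
move=> n0 xnd ynd xy1.
set e := (n%:R%:E * _)%E.
pose t (i : nat) := (x i - y i) ^+ 2 / 2.
have t01 (i : 'I_n) : 0 <= t i <= 2^-1.
  rewrite /t mulr_ge0 ?sqr_ge0//= ler_piMl//.
  by rewrite -real_normK ?num_real// exprn_ile1// ltW// xy1.
have t1 (i : 'I_n) : 0 < 1 - t i.
  have /andP[_ H] := t01 i; rewrite subr_gt0 (le_lt_trans H)//.
  by rewrite invf_lt1// ltr1n.
pose L := \sum_(i < n) - ln (1 - t i).
have LE : \prod_(i < n) (1 - (x i - y i) ^+ 2 / 2) = expR (- L).
  rewrite /L sumrN opprK expR_sum; apply: eq_bigr => i _.
  by rewrite lnK// posrE t1.
have Le : (L%:E <= e)%E.
  apply/lee_addgt0Pr => eps eps0.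
  (* Truncating the series at N costs n * 2 ^ - N in total. *)
  have [N HN] : exists N, n%:R * 2 ^- N <= eps.
    pose N := (Num.truncn (n%:R / eps)).+1; exists N.
    rewrite -[leLHS]/(n%:R / (2 ^+ N)) ler_pdivrMr ?exprn_gt0// mulrC -ler_pdivrMr//.
    apply: (@le_trans _ _ (N%:R)); last by rewrite -natrX ler_nat ltnW// ltn_expl.
    by apply/ltW/truncnS_gt; rewrite divr_ge0.
  apply: (@le_trans _ _ ((\sum_(i < n) log_sum N (t i))%:E + eps%:E)%E).
    rewrite -EFinD lee_fin -lerBlDr.
    apply: (@le_trans _ _ (L - n%:R * 2 ^- N)); first by rewrite lerB.
    rewrite /L mulr_natl -[in X in _ - X](card_ord n) -sumr_const -sumrB.
    by apply: ler_sum => i _; exact: log_sum_ge.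
  apply: leeD => //.
  rewrite /e; pose u k : \bar R := (((k%:R * 2 ^+ k)^-1)%:E *
       wasserstein (2 * k)%N%:R (empirical_measure n x) (empirical_measure n y)
         ^+ (2 * k)%N)%E.
  have wge0 k : (1 <= k)%N -> (0 <= u k)%E.
    move=> k0; apply: mule_ge0; first by rewrite lee_fin invr_ge0 mulr_ge0// exprn_ge0.
    by apply: expe_ge0; exact: poweR_ge0.
  apply: (@le_trans _ _ (n%:R%:E * \sum_(1 <= k < N.+1) u k)%E); last first.
    by apply: lee_wpmul2l => //; apply: nneseries_lim_ge => k k1 _; exact: wge0.
  pose v k : R := (k%:R * 2 ^+ k)^-1 * (n%:R^-1 * \sum_(i < n) (x i - y i) ^+ (2 * k)).
  apply: (@le_trans _ _ (n%:R%:E * \sum_(1 <= k < N.+1) (v k)%:E)%E); last first.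
    apply: lee_wpmul2l => //; rewrite big_nat [leRHS]big_nat.
    apply: lee_sum => k /andP[k1 _].
    rewrite /u /v EFinM; apply: lee_wpmul2l.
      by rewrite lee_fin invr_ge0 mulr_ge0// exprn_ge0.
    exact: wasserstein_even_ge.
  rewrite sumEFin -EFinM lee_fin /v /log_sum exchange_big /= big_add1 /=.
  rewrite big_mkord mulr_sumr.
  rewrite le_eqVlt; apply/orP; left; apply/eqP; apply: eq_bigr => k _.
  rewrite mulrCA [n%:R * _]mulrA mulfV ?mul1r ?pnatr_eq0 -?lt0n// mulr_sumr.
  apply: eq_bigr => i _; rewrite /t exprM exprMn exprVn invfM.
  by rewrite -mulrA [RHS]mulrC [X in _ = _ * X]mulrC.
rewrite LE -[leRHS]/(fine (expeR (- L)%:E)).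
have He : (expeR (- e) <= expeR (- L)%:E)%E by rewrite lee_expeR EFinN leeN2.
apply: fine_le => //.
by rewrite ge0_fin_numE ?expeR_ge0// (le_lt_trans He)//= ltry.
Qed.

End WassersteinBound.

(** * One-sided derivatives on the unit interval *)

Section Derive01.
Context (R : realType).

Let quot_cvg (g : R -> R) (t l : R) :=
  (s - t)^-1 * (g s - g t) @[s --> within `[0, 1] t^'] --> l.

Lemma quot01_coord_cvg (d : nat) (f : R -> 'rV[R]_d) (i : 'I_d) (t : R) :
  derivable01 f -> t \in `[0, 1] ->
  (s - t)^-1 * (f s 0 i - f t 0 i) @[s --> within `[0, 1] t^'] --> derive01 f t 0 i.
Proof.
move=> df t01; have := df t t01.
move=> /(@cvg_comp _ _ _ _ (fun v : 'rV[R]_d => v 0 i) _ _ _)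
  /(_ (@coord_continuous R 1 d 0 i _)).
by apply: cvg_trans; apply: near_eq_cvg; near=> s; rewrite /quot01 /= !mxE.
Unshelve. all: by end_near. Qed.

Lemma quot_cvg_continuous (g : R -> R) (t l : R) :
  quot_cvg g t l -> g s @[s --> within `[0, 1] (nbhs t)] --> g t.
Proof.
move=> H.
have idt : (s : R) @[s --> within `[0, 1] t^'] --> t.
  by apply: cvg_trans (cvg_within _) _; exact: nbhs_dnbhs.
have : g t + (s - t) * ((s - t)^-1 * (g s - g t)) @[s --> within `[0, 1] t^']
    --> g t + (t - t) * l.
  apply: cvgD; first exact: cvg_cst.
  by apply: cvgM => //; apply: cvgB => //; exact: cvg_cst.
rewrite subrr mul0r addr0 => /cvgrPdist_lt K.
apply/cvgrPdist_lt => e e0; have Ke : \forall s \near t, s != t -> `[0, 1]%classic s ->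
    `|g t - (g t + (s - t) * ((s - t)^-1 * (g s - g t)))| < e := K e e0.
apply: filterS Ke => s Ks s01.
have [->|st] := eqVneq s t; first by rewrite subrr normr0.
have := Ks st s01; rewrite mulrA divff ?mul1r ?subr_eq0//.
by rewrite addrCA subrr addr0.
Qed.

Lemma quot_cvg_is_derive (g : R -> R) (t l : R) : 0 < t < 1 ->
  quot_cvg g t l -> is_derive t 1 g l.
Proof.
move=> /andP[t0 t1] H.
have K : h^-1 *: ((g \o shift t) (h *: (1:R)) - g t) @[h --> 0^'] --> l.
  apply/cvgrPdist_lt => e e0.
  have [e1 /= e10 He] : \forall s \near t, s != t -> `[0, 1]%classic s ->
      `|l - (s - t)^-1 * (g s - g t)| < e.
    by have /cvgrPdist_lt/(_ e e0) := H.
  have mt : 0 < Num.min e1 (Num.min t (1 - t)) by rewrite !lt_min e10 t0 subr_gt0.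
  exists (Num.min e1 (Num.min t (1 - t))) => //= h.
  rewrite /ball_ /= sub0r normrN !lt_min => /and3P[he1 ht ht1] h0.
  rewrite /GRing.scale/= mulr1.
  have := He (h + t); rewrite addrK; apply.
  - by rewrite /ball_ /= opprD addrCA subrr addr0 normrN.
  - by rewrite -subr_eq0 addrK.
  - move: ht ht1; rewrite !ltr_norml => /andP[h1 _] /andP[_ h2].
    by rewrite /= in_itv/=; lra.
by apply: DeriveDef; [apply/cvg_ex; exists l|rewrite /derive; exact: cvg_lim].
Qed.

End Derive01.

(** * The speed of the reparametrization *)

Section SpeedCdf.
Context (R : realType) (kap : R -> R) (a b : R) (F : R -> R).
Hypothesis kap_cont : {within `[0, 1], continuous kap}.
Hypothesis kap_gt0 : forall s, s \in `[0, 1] -> 0 < kap s.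
Hypothesis ltab : a < b.
Hypothesis F_cdf : is_cdf_on a b F.
Hypothesis F_int : forall t : R, t \in `[a, b] ->
  F t = \int[lebesgue_measure]_(s in `[a, t]) (kap (F s))^-1.

Let q (s : R) : R := (kap (F s))^-1.

Let F01 s : s \in `[a, b] -> F s \in `[0, 1].
Proof. by move=> sab; rewrite in_itv/=; case: F_cdf => H _ _ _ _; exact: H. Qed.

Let kapV_cont : {within `[0, 1], continuous (fun s => (kap s)^-1)}.
Proof.
apply/subspace_continuousP => x x01.
apply: cvgV; first by rewrite gt_eqF// kap_gt0.
by move/subspace_continuousP : kap_cont; apply.
Qed.

Let q_bounds : exists2 m : R, 0 < m & exists2 M : R, 0 < M &
  forall s, s \in `[a, b] -> m <= q s <= M.
Proof.
have [c c01 cmax] := EVT_max ler01 kap_cont.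
have [e e01 emin] := EVT_min ler01 kap_cont.
exists (kap c)^-1; first by rewrite invr_gt0 kap_gt0.
exists (kap e)^-1; first by rewrite invr_gt0 kap_gt0.
move=> s sab; rewrite /q !lef_pV2 ?posrE ?kap_gt0 ?F01//.
by rewrite cmax ?emin// F01.
Qed.

Let measurable_q : measurable_fun `[a, b] q.
Proof.
rewrite -[q]/((fun s => (kap s)^-1) \o F).
apply: (@measurable_comp _ _ _ R R R `[0, 1]%classic (fun s : R => (kap s)^-1)
  `[a, b]%classic F) => //.
- by move=> _ [s sab <-]; exact: F01.
- exact: subspace_continuous_measurable_fun.
(* F is monotone on [a, b] only: it is extended by clamping the argument. *)
pose G s := F (Num.max a (Num.min s b)).
apply: (@eq_measurable_fun _ _ _ _ _ G) => [s|].
  rewrite inE/= in_itv/= => /andP[sa sb].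
  by rewrite /G (min_idPl sb) (max_idPr sa).
apply: nondecreasing_measurable => // x y xy; rewrite /G.
case: F_cdf => _ nd _ _ _; apply: nd.
- by rewrite in_itv/= le_max lexx ge_max ge_min lexx orbT (ltW ltab).
- by rewrite in_itv/= le_max lexx ge_max ge_min lexx orbT (ltW ltab).
- have H : Num.min x b <= Num.min y b by rewrite le_min !ge_min xy lexx orbT.
  by rewrite ge_max !le_max lexx H orbT.
Qed.

Let integrable_q : lebesgue_measure.-integrable `[a, b] (EFin \o q).
Proof.
have [m m0 [M M0 mM]] := q_bounds.
apply: (@itv_bounded_integrable _ _ _ q M) => // t tab.
have /andP[mq qM] := mM t tab.
by rewrite ger0_norm// (le_trans (ltW m0)).
Qed.

(** The density of F is the inverse of kap, which is continuous and positive on a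
    compact interval. *)
Lemma cdf_increment : exists2 m : R, 0 < m & exists2 M : R, 0 < M &
  forall s t, a <= s -> s <= t -> t <= b ->
    m * (t - s) <= F t - F s <= M * (t - s).
Proof.
have [m m0 [M M0 mM]] := q_bounds.
exists m => //; exists M => // s t sa st tb.
have tab : t \in `[a, b] by rewrite in_itv/= (le_trans sa st) tb.
have sab : s \in `[a, b] by rewrite in_itv/= sa (le_trans st tb).
have sub1 : `[a, t]%classic `<=` `[a, b]%classic.
  by apply: subset_itvl; rewrite bnd_simp.
have sub2 : `]s, t]%classic `<=` `[a, b]%classic.
  move=> u; rewrite /= !in_itv/= => /andP[su ut].
  by rewrite (le_trans sa (ltW su)) (le_trans ut tb).
rewrite F_int// F_int//.
rewrite (@Rintegral_itvB _ q (BLeft a) (BRight t) s); last 3 first.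
- by apply: integrableS integrable_q.
- by rewrite bnd_simp.
- by rewrite bnd_simp.
have fin : (lebesgue_measure `]s, t]%classic = (t - s)%:E)%E.
  rewrite lebesgue_measure_itv/= lte_fin; case: ltP => //.
  by move=> ts; rewrite (_ : t = s) ?subrr//; apply/eqP; rewrite eq_le ts st.
have cstE (c : R) : \int[lebesgue_measure]_(u in `]s, t]) c = c * (t - s).
  rewrite Rintegral_cst//; congr (c * _).
  by rewrite -[RHS]/(fine (t - s)%:E) -fin.
have cst_int (c : R) : lebesgue_measure.-integrable `]s, t] (EFin \o cst c).
  have ci : lebesgue_measure.-integrable `[s, t] (EFin \o cst c).
    exact: (@itv_bounded_integrable _ _ _ _ `|c|).
  by apply: integrableS ci => //; exact: subset_itv_oc_cc.
rewrite -!cstE; apply/andP; split; apply: le_Rintegral => //.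
- exact: cst_int.
- by apply: integrableS integrable_q.
- by move=> u /sub2 /mM /andP[].
- by apply: integrableS integrable_q.
- exact: cst_int.
- by move=> u /sub2 /mM /andP[].
Qed.

Lemma cdf_increasing : {in `[a, b] &, {homo F : x y / x < y}}.
Proof.
move=> x y; rewrite !in_itv/= => /andP[ax xb] /andP[ay yb] xy.
have [m m0 [M M0 H]] := cdf_increment.
have /andP[H1 _] := H x y ax (ltW xy) yb.
by rewrite -subr_gt0 (lt_le_trans _ H1)// mulr_gt0// subr_gt0.
Qed.

Lemma cdf_continuous : {within `[a, b], continuous F}.
Proof.
have [m m0 [M M0 H]] := cdf_increment.
have lip s t : s \in `[a, b] -> t \in `[a, b] -> `|F t - F s| <= M * `|t - s|.
  rewrite !in_itv/= => /andP[sa sb] /andP[ta tb].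
  have [st|/ltW ts] := leP s t.
    have /andP[H1 H2] := H s t sa st tb.
    rewrite !ger0_norm ?subr_ge0// -subr_ge0 (le_trans _ H1)//.
    by rewrite mulr_ge0 ?subr_ge0// ltW.
  have /andP[H1 H2] := H t s ta ts sb.
  rewrite distrC [X in M * X]distrC !ger0_norm ?subr_ge0// -subr_ge0 (le_trans _ H1)//.
  by rewrite mulr_ge0 ?subr_ge0// ltW.
apply/subspace_continuousP => x xab; apply/cvgrPdist_lt => e e0.
have xs : \forall s \near x, `|x - s| < e / M.
  by exists (e / M) => //=; rewrite divr_gt0.
suff : \forall s \near x, `[a, b]%classic s -> `|F x - F s| < e by [].
apply: filterS xs => s xs sab; apply: le_lt_trans (lip s x sab xab) _.
by rewrite mulrC -ltr_pdivlMr.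
Qed.

Lemma cdf_itvoo t : t \in `]a, b[ -> F t \in `]0, 1[.
Proof.
case: F_cdf => _ _ _ Fa Fb; rewrite !in_itv/= => /andP[ta tb].
rewrite -Fa -Fb !cdf_increasing// in_itv/= ?lexx ?(ltW ltab) ?(ltW ta) ?(ltW tb)//.
Qed.

(** The fundamental theorem of calculus, the density being continuous as F and kap
    are. *)
Lemma cdf_is_derive t : t \in `]a, b[ -> is_derive t 1 F (kap (F t))^-1.
Proof.
move=> tab; have /andP[ta tb] : a < t < b by rewrite in_itv/= in tab.
have qc : {for t, continuous q}.
  apply: (@continuous_comp _ _ _ F (fun s => (kap s)^-1)).
    exact: (within_continuous_continuous ltab cdf_continuous tab).
  exact: (within_continuous_continuous ltr01 kapV_cont (cdf_itvoo tab)).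
have := @continuous_FTC1 _ q (BLeft a) t b tb integrable_q.
move=> /(_ _ qc); rewrite /= lte_fin => /(_ ta) [dF F'].
set G := fun x => \int[lebesgue_measure]_(u in `[a, x]) q u in dF F'.
have FG : \forall x \near t, G x = F x.
  have : \forall x \near t, x \in `]a, b[ by exact: near_in_itvoo.
  apply: filterS => x; rewrite in_itv/= => /andP[xa xb].
  by rewrite F_int// in_itv/= !ltW.
have GD : is_derive t 1 G (q t).
  by rewrite -F' derive1E; exact: DeriveDef.
exact: near_eq_is_derive FG GD.
Qed.

End SpeedCdf.

(** * The tangent of the reparametrized curve *)

Lemma pinv_notin (T U : Type) (x0 : T) (A : set T) (f : T -> U) (y : U) :
  ~ (f @` A) y -> 'pinv_(fun=> x0) A f y = x0.
Proof.
move=> ny; rewrite /pinv_ splitV.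
(* The partial inverse unfolds to a chosen preimage on the image of f, and to the
   default value elsewhere. *)
change (odflt x0 (if pselect ((f @` A) y) is left By
  then Some (projT1 (cid2 By)) else None) = x0).
by case: pselect.
Qed.

Lemma pinv_mem (T U : Type) (x0 : T) (A : set T) (f : T -> U) (y : U) :
  A x0 -> A ('pinv_(fun=> x0) A f y).
Proof.
move=> Ax0; rewrite /pinv_ splitV.
change (A (odflt x0 (if pselect ((f @` A) y) is left By
  then Some (projT1 (cid2 By)) else None))).
by case: pselect => // ?; case: cid2.
Qed.

Section SumsOfSquares.
Context (R : realType).

Lemma sum_sqr_ge0 (I : finType) (e : I -> R) : 0 <= \sum_j e j ^+ 2.
Proof. by apply: sumr_ge0 => j _; exact: sqr_ge0. Qed.

Lemma cauchy_schwarz_sum (I : finType) (e v : I -> R) :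
  (\sum_j e j * v j) ^+ 2 <= (\sum_j e j ^+ 2) * (\sum_j v j ^+ 2).
Proof.
set A := \sum_j e j ^+ 2; set B := \sum_j v j ^+ 2; set C := \sum_j _.
have B0 : 0 <= B by exact: sum_sqr_ge0.
have [BE|BN] := eqVneq B 0.
  have v0 j : v j = 0.
    apply/eqP; rewrite -sqrf_eq0.
    move/eqP: BE; rewrite /B psumr_eq0 => [/allP/(_ j (mem_index_enum j))//|k _].
    exact: sqr_ge0.
  by rewrite BE mulr0 /C big1 ?expr0n// => j _; rewrite v0 mulr0.
have Bgt : 0 < B by rewrite lt_neqAle eq_sym BN.
(* Lagrange: this sum of squares is B * (A * B - C ^ 2). *)
have : 0 <= \sum_j (B * e j - C * v j) ^+ 2 by exact: sum_sqr_ge0.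
have -> : \sum_j (B * e j - C * v j) ^+ 2 = B * (A * B - C ^+ 2).
  transitivity (\sum_j
      (B ^+ 2 * e j ^+ 2 - (2 * B * C) * (e j * v j) + C ^+ 2 * v j ^+ 2)).
    by apply: eq_bigr => j _; ring.
  by rewrite big_split sumrB/= -!mulr_sumr -/A -/B -/C; ring.
by rewrite pmulr_rge0// subr_ge0.
Qed.

End SumsOfSquares.

Section CurveAngle.
Context (R : realType) (d : nat) (gamma : R -> 'rV[R]_d).
Hypothesis gamma_C2 : C2_01 gamma.
Hypothesis gamma_unit_speed :
  forall s : R, s \in `[0, 1] -> enorm (derive01 gamma s) = 1.
Hypothesis curv_neq0 : forall s : R, s \in `[0, 1] ->
  enorm (derive01 (derive01 gamma) s) != 0.

Let tangent (j : 'I_d) (s : R) : R := derive01 gamma s 0 j.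
Let accel (j : 'I_d) (s : R) : R := derive01 (derive01 gamma) s 0 j.
Let kap (s : R) : R := enorm (derive01 (derive01 gamma) s).

Lemma sqr_enorm (v : 'rV[R]_d) : enorm v ^+ 2 = \sum_j v 0 j ^+ 2.
Proof. by rewrite /enorm sqr_sqrtr// sum_sqr_ge0. Qed.

Lemma tangent_continuous (j : 'I_d) : {within `[0, 1], continuous (tangent j)}.
Proof.
have [_ dT _] := gamma_C2.
apply/subspace_continuousP => t t01.
apply: (@quot_cvg_continuous _ (tangent j) t (accel j t)).
exact: quot01_coord_cvg.
Qed.

Lemma tangent_is_derive (j : 'I_d) (t : R) :
  t \in `]0, 1[ -> is_derive t 1 (tangent j) (accel j t).
Proof.
have [_ dT _] := gamma_C2 => t01; apply: (@quot_cvg_is_derive _ (tangent j)).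
  by rewrite in_itv/= in t01.
apply: quot01_coord_cvg => //.
by move: t01; rewrite !in_itv/= => /andP[/ltW -> /ltW ->].
Qed.

Lemma enorm_continuous : continuous (@enorm R d).
Proof.
move=> v; rewrite /enorm.
apply: (@continuous_comp _ _ _ (fun v : 'rV[R]_d => \sum_j v 0 j ^+ 2) Num.sqrt).
  apply: (@cvg_big R _ +%R 0 xpredT (@add_continuous _) _ (nbhs v)) => j _.
  rewrite expr2; under eq_fun do rewrite expr2.
  by apply: cvgM; exact: coord_continuous.
exact: sqrt_continuous.
Qed.

Lemma curv_continuous : {within `[0, 1], continuous kap}.
Proof.
have [_ _ cN] := gamma_C2.
move=> s; apply: (@continuous_comp (subspace _) _ _ (derive01 (derive01 gamma))
  (@enorm R d)).
  exact: cN.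
exact: enorm_continuous.
Qed.

Lemma curv_gt0 s : s \in `[0, 1] -> 0 < kap s.
Proof. by move=> s01; rewrite lt_neqAle eq_sym curv_neq0//= sqrtr_ge0. Qed.

Section Reparametrization.
Variables (a b : R) (F : R -> R).
Hypothesis ltab : a < b.
Hypothesis F_cdf : speed_cdf gamma a b F.

Let cdf : is_cdf_on a b F. Proof. by case: F_cdf. Qed.
Let F_int : forall t : R, t \in `[a, b] ->
  F t = \int[lebesgue_measure]_(s in `[a, t]) (kap (F s))^-1.
Proof. by case: F_cdf. Qed.
Let F01 (s : R) : s \in `[a, b] -> F s \in `[0, 1].
Proof. by move=> sab; rewrite in_itv/=; case: cdf => H _ _ _ _; exact: H. Qed.

Lemma tangent_comp_cvg (j : 'I_d) (s : R) : s \in `[a, b] ->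
  tangent j (F t) @[t --> within `[a, b] (nbhs s)] --> tangent j (F s).
Proof.
move=> sab.
have /subspace_continuousP/(_ (F s) (F01 sab)) Tc := @tangent_continuous j.
apply: cvg_comp Tc => B HB.
have /subspace_continuousP/(_ s sab) Fc :=
  cdf_continuous curv_continuous curv_gt0 ltab cdf F_int.
suff : \forall t \near s, `[a, b]%classic t -> B (F t) by [].
have : \forall t \near s, `[a, b]%classic t -> `[0, 1]%classic (F t) -> B (F t).
  exact: (Fc _ HB).
by apply: filterS => t H tab; apply: H => //; exact: F01.
Qed.

(** The curve t |-> gamma'(F t) has unit speed since F' = 1 / |gamma''(F)|, so a
    chord is at most as long as the parameter interval it spans. *)
Lemma tangent_lipschitz_le (x y : R) : a <= x -> x <= y -> y <= b ->
  \sum_j (tangent j (F y) - tangent j (F x)) ^+ 2 <= (y - x) ^+ 2.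
Proof.
move=> ax; rewrite le_eqVlt => /predU1P[<- _|xy yb].
  by rewrite subrr expr0n/= big1// => j _; rewrite subrr expr0n.
(* Apply the mean value theorem to the component of the tangent along its own
   increment e: its derivative is at most the length of e. *)
pose e j := tangent j (F y) - tangent j (F x).
set S := \sum_j _.
pose h t := \sum_j e j * tangent j (F t).
pose dh t := \sum_j e j * (accel j (F t) * (kap (F t))^-1).
have hS : h y - h x = S.
  by rewrite /h -sumrB; apply: eq_bigr => j _; rewrite -mulrBr -expr2.
have sub : `[x, y]%classic `<=` `[a, b]%classic.
  move=> t; rewrite /= !in_itv/= => /andP[xt ty].
  by rewrite (le_trans ax xt) (le_trans ty yb).
have hd (t : R) : t \in `]x, y[ -> is_derive t 1 h (dh t).
  rewrite in_itv/= => /andP[xt ty].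
  have tab : t \in `]a, b[.
    by rewrite in_itv/= (le_lt_trans ax xt) (lt_le_trans ty yb).
  have dF := cdf_is_derive curv_continuous curv_gt0 ltab cdf F_int tab.
  have F01o := cdf_itvoo curv_continuous curv_gt0 ltab cdf F_int tab.
  have -> : h = \sum_j (e j \*: (tangent j \o F)).
    by apply/funext => u; rewrite fct_sumE.
  apply: is_derive_sum => j; apply: is_deriveZ.
  by apply: is_derive1_comp; exact: tangent_is_derive.
have hc : {within `[x, y], continuous h}.
  apply: continuous_subspaceW sub _.
  apply/subspace_continuousP => s sab.
  apply: (@cvg_big R _ +%R 0 xpredT (@add_continuous _) _
    (within `[a, b] (nbhs s))) => j _.
  apply: cvgM; [exact: cvg_cst|exact: tangent_comp_cvg].
have [c cxy hE] := MVT xy hd hc.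
rewrite hS in hE.
have S0 : 0 <= S by exact: sum_sqr_ge0.
have cab : c \in `[a, b].
  by apply: sub; move: cxy; rewrite /= !in_itv/= => /andP[/ltW -> /ltW ->].
have k0 : 0 < kap (F c) by apply: curv_gt0; exact: F01.
have dh_le : dh c ^+ 2 <= S.
  have -> : dh c = (\sum_j e j * accel j (F c)) / kap (F c).
    by rewrite /dh mulr_suml; apply: eq_bigr => j _; rewrite mulrA.
  rewrite exprMn exprVn ler_pdivrMr ?exprn_gt0//.
  by rewrite /kap sqr_enorm; exact: cauchy_schwarz_sum.
have [->|SN] := eqVneq S 0; first exact: sqr_ge0.
have Sgt : 0 < S by rewrite lt_neqAle eq_sym SN.
rewrite -(ler_pM2l Sgt) -expr2 {1}hE exprMn ler_wpM2r// sqr_ge0//.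
Qed.

Lemma tangent_lipschitz (x y : R) : x \in `[a, b] -> y \in `[a, b] ->
  \sum_j (tangent j (F x) - tangent j (F y)) ^+ 2 <= (x - y) ^+ 2.
Proof.
rewrite !in_itv/= => /andP[ax xb] /andP[ay yb].
have [xy|/ltW yx] := leP x y; last exact: tangent_lipschitz_le.
rewrite -sqrrN opprB; apply: le_trans (tangent_lipschitz_le ax xy yb).
by apply: ler_sum => j _; rewrite -sqrrN opprB.
Qed.

(** For unit vectors, <u, v> = 1 - |u - v|^2 / 2. *)
Lemma tangent_inner_ge (x y : R) : x \in `[a, b] -> y \in `[a, b] ->
  1 - (x - y) ^+ 2 / 2 <= \sum_j tangent j (F x) * tangent j (F y).
Proof.
move=> xab yab; have := tangent_lipschitz xab yab.
have u (s : R) : s \in `[a, b] -> \sum_j tangent j (F s) ^+ 2 = 1.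
  move=> sab; rewrite -(sqr_enorm (derive01 gamma (F s))).
  by rewrite gamma_unit_speed ?expr1n//; exact: F01.
suff -> : \sum_j (tangent j (F x) - tangent j (F y)) ^+ 2 =
  2 - 2 * \sum_j tangent j (F x) * tangent j (F y) by lra.
set S := \sum_j tangent j (F x) * tangent j (F y).
transitivity (\sum_j tangent j (F x) ^+ 2 + \sum_j tangent j (F y) ^+ 2
  - 2 * S).
  rewrite /S mulr_sumr -big_split -sumrB/=; apply: eq_bigr => j _.
  by rewrite sqrrB mulr_natl addrAC.
by rewrite (u x xab) (u y yab); congr (_ - _); rewrite -mulr2n.
Qed.

Let Finv : R -> R := 'pinv_(fun=> a) `[a, b] F.

Lemma Finv_mem t : Finv t \in `[a, b].
Proof. by apply: (@pinv_mem _ _ a `[a, b]%classic); rewrite /= in_itv/= lexx ltW. Qed.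

Lemma F_Finv t : t \in `[0, 1] -> F (Finv t) = t.
Proof.
move=> t01; apply: (pinvK (fun=> a)); rewrite inE/=.
case: (cdf) => _ _ _ Fa Fb.
have [] := @IVT _ F a b t (ltW ltab)
  (cdf_continuous curv_continuous curv_gt0 ltab cdf F_int).
  by rewrite Fa Fb (min_idPl ler01) (max_idPr ler01); rewrite in_itv/= in t01.
by move=> c cab <-; exists c.
Qed.

Lemma Finv_out t : t \notin `[0, 1] -> Finv t = a.
Proof.
move=> t01; apply: pinv_notin => -[s sab Fst]; case/negP: t01.
by rewrite -Fst; exact: F01.
Qed.

Lemma Finv_homo : {in `[0, 1] &, {homo Finv : s t / s <= t}}.
Proof.
move=> s t s01 t01 st; rewrite leNgt; apply/negP => H.
have := cdf_increasing curv_continuous curv_gt0 ltab cdf F_int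
  (Finv_mem t) (Finv_mem s) H.
by rewrite !F_Finv// ltNge st.
Qed.

(** Finv is monotone on [0, 1] and constant elsewhere. *)
Lemma measurable_Finv : measurable_fun setT Finv.
Proof.
have -> : Finv =
    fun t => if t \in `[0, 1] then Finv (Num.max 0 (Num.min t 1)) else a.
  apply/funext => t; case: ifPn => [|/Finv_out//].
  by rewrite in_itv/= => /andP[t0 t1]; rewrite (min_idPl t1) (max_idPr t0).
apply: measurable_fun_ifT => //.
- under eq_fun do rewrite in_itv/=.
  by apply: measurable_and => //; exact: measurable_fun_ler.
- apply: nondecreasing_measurable => // x y xy; apply: Finv_homo.
  + by rewrite in_itv/= le_max lexx ge_max ge_min lexx orbT ler01.
  + by rewrite in_itv/= le_max lexx ge_max ge_min lexx orbT ler01.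
  + have H : Num.min x 1 <= Num.min y 1 by rewrite le_min !ge_min xy lexx orbT.
    by rewrite ge_max !le_max lexx H orbT.
Qed.

Lemma measurable_tangent_Finv (j : 'I_d) :
  measurable_fun setT (fun t => tangent j (F (Finv t))).
Proof.
have [_ Fnd _ Fa Fb] := cdf.
have FFE t : F (Finv t) = if t \in `[0, 1] then t else 0.
  case: ifPn => [/F_Finv//|/Finv_out ->]; exact: Fa.
apply: (@measurable_comp _ _ _ R R R `[0, 1]%classic (tangent j) setT
  (fun t => F (Finv t))) => //.
- by move=> _ [t _ <-]; apply: F01; exact: Finv_mem.
- by apply: subspace_continuous_measurable_fun => //; exact: tangent_continuous.
- under eq_fun do rewrite FFE; apply: measurable_fun_ifT => //.
  under eq_fun do rewrite in_itv/=.
  by apply: measurable_and => //; exact: measurable_fun_ler.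
Qed.

End Reparametrization.
End CurveAngle.

(** * The lower bound *)

Theorem proposition17 (R : realType) (d : nat) (gamma : R -> 'rV[R]_d)
    (gamma_C2 : C2_01 gamma)
    (gamma_unit_speed : forall s : R, s \in `[0, 1] -> enorm (derive01 gamma s) = 1)
    (curv_neq0 : forall s : R, s \in `[0, 1] ->
       enorm (derive01 (derive01 gamma) s) != 0)
    (curv_derivable :
       derivable01 (fun s : R => enorm (derive01 (derive01 gamma) s)))
    (curv_derive_bounded : exists M : R, forall s : R, s \in `[0, 1] ->
       `|derive01 (fun s : R => enorm (derive01 (derive01 gamma) s)) s| <= M)
    (a b : R) (ltab : a < b) (F : R -> R) (F_cdf : speed_cdf gamma a b F)
    (n : nat) (n_gt0 : (0 < n)%N)
    (disp : measure_display) (T : measurableType disp) (P : probability T R)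
    (U V : 'I_n -> {RV P >-> R})
    (U_iid : iid_uniform01 U) (V_iid : iid_uniform01 V)
    (UV_indep : independent_families P
       (fun i : 'I_n => order_stat U i) (fun i : 'I_n => order_stat V i)) :
  let Finv : R -> R := 'pinv_(fun=> a) `[a, b] F in
  let X (i : nat) (omega : T) : R := Finv (order_stat U i omega) in
  let Y (i : nat) (omega : T) : R := Finv (order_stat V i omega) in
  let muX (omega : T) := empirical_measure n (fun i => X i omega) in
  let muY (omega : T) := empirical_measure n (fun i => Y i omega) in
  let maxdist (omega : T) : R :=
    \big[Num.max/0]_(i < n) `|X i omega - Y i omega| in
  let exponent (omega : T) : \bar R :=
    (n%:R%:E * \sum_(1 <= k <oo) ((k%:R * 2 ^+ k)^-1)%:E *
       wasserstein (2 * k)%N%:R (muX omega) (muY omega) ^+ (2 * k)%N)%E in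
  ('E_P[fun omega : T => (fine (expeR (- exponent omega)) *
                          \1_[set omega' | maxdist omega' < 1] omega)%R]
     - P [set omega | (1 <= maxdist omega)%R]
   <= (n`!%:R ^+ 2 * hs_norm (signature gamma n) ^+ 2)%:E)%E.
Proof.
pose Finv : R -> R := 'pinv_(fun=> a) `[a, b] F.
pose X (i : nat) (omega : T) : R := Finv (order_stat U i omega).
pose Y (i : nat) (omega : T) : R := Finv (order_stat V i omega).
pose maxdist (omega : T) : R := \big[Num.max/0]_(i < n) `|X i omega - Y i omega|.
pose exponent (omega : T) : \bar R :=
  (n%:R%:E * \sum_(1 <= k <oo) ((k%:R * 2 ^+ k)^-1)%:E *
     wasserstein (2 * k)%N%:R (empirical_measure n (fun i => X i omega))
       (empirical_measure n (fun i => Y i omega)) ^+ (2 * k)%N)%E.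
pose tangent (j : 'I_d) (s : R) : R := derive01 gamma s 0 j.
(* On [0, 1], g is the tangent of gamma; elsewhere it is still a unit vector,
   which makes the bounds below hold at every sample point. *)
pose g (j : 'I_d) (t : R) : R := tangent j (F (Finv t)).
have cdf : is_cdf_on a b F by case: F_cdf.
have FinvM t : Finv t \in `[a, b] by exact: Finv_mem.
have FFinv01 t : F (Finv t) \in `[0, 1].
  by rewrite in_itv/=; case: cdf => H _ _ _ _; exact: H.
have g_unit t : \sum_j g j t ^+ 2 = 1.
  rewrite /g /tangent -(sqr_enorm (derive01 gamma (F (Finv t)))).
  by rewrite gamma_unit_speed ?expr1n.
have mg j : measurable_fun setT (g j).
  exact: (measurable_tangent_Finv gamma_C2 curv_neq0 ltab F_cdf).
have g1 j t : `|g j t| <= 1.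
  rewrite -(@ler_pXn2r _ 2)// ?nnegrE// expr1n real_normK ?num_real// -(g_unit t).
  by rewrite (bigD1 j)//= lerDl sumr_ge0// => k _; exact: sqr_ge0.
pose Q (s t : R) := \sum_j g j s * g j t.
have Q_le1 s t : `|Q s t| <= 1.
  rewrite -(@ler_pXn2r _ 2)// ?nnegrE// expr1n real_normK ?num_real//.
  by apply: (le_trans (cauchy_schwarz_sum _ _)); rewrite !g_unit mulr1.
have Q_ge s t : 1 - (Finv s - Finv t) ^+ 2 / 2 <= Q s t.
  exact: (tangent_inner_ge gamma_C2 gamma_unit_speed curv_neq0 ltab F_cdf).
pose oU (i : nat) := order_stat U i; pose oV (i : nat) := order_stat V i.
have moU (i : 'I_n) : measurable_fun setT (oU i) by exact: measurable_order_stat.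
have moV (i : 'I_n) : measurable_fun setT (oV i) by exact: measurable_order_stat.
pose G o := \prod_(i < n) Q (oU i o) (oV i o).
have G_le1 o : `|G o| <= 1.
  by rewrite normr_prod prodr_ile1// => i _; rewrite normr_ge0 Q_le1.
have mG : measurable_fun setT G.
  apply: measurable_prod => i _; apply: measurable_sum => j.
  by apply: measurable_funM; exact: measurableT_comp.
have GE : \int[P]_o G o = n`!%:R ^+ 2 * hs_norm (signature gamma n) ^+ 2.
  rewrite (expectation_prod_inner mg g1 U_iid V_iid UV_indep); congr (_ * _).
  rewrite /hs_norm sqr_sqrtr; last by apply: sumr_ge0 => w _; rewrite -expr2 sqr_ge0.
  apply: eq_bigr => w _; rewrite ffunE -expr2; congr (_ ^+ 2).
  have gE j t : t \in `[0, 1] -> g j t = derive01 gamma t 0 j.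
    by move=> t01; rewrite /g /tangent (F_Finv gamma_C2 curv_neq0 ltab F_cdf t01).
  by apply: iterated_integral_simplex; first exact: gE.
have mFinv : measurable_fun setT Finv.
  exact: (measurable_Finv gamma_C2 curv_neq0 ltab F_cdf).
have mmax : measurable_fun setT maxdist.
  apply: measurable_bigmax => i; apply: measurableT_comp => //.
  by apply: measurable_funB; exact: measurableT_comp.
pose far := [set o | (1 <= maxdist o)%R].
have mfar : measurable far.
  by rewrite -[far]setTI; exact: measurable_fun_le.
(* Off a null set N all samples lie in [0, 1], so that X and Y are sorted. *)
have [N [mN PN badN]] : {ae P, forall o, forall i, (i < n)%N ->
    oU i o \in `[0, 1] /\ oV i o \in `[0, 1]}.
  apply: filterS2 (order_stat_ae01 U_iid) (order_stat_ae01 V_iid) => o HU HV i ltin.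
  by split; [exact: HU|exact: HV].
(* h dominates the integrand f everywhere: G does where the samples are close,
   and adding 1 on far or 2 on N makes up for G >= -1. *)
pose h o := G o + \1_far o + 2 * \1_N o.
pose f o := fine (expeR (- exponent o)) * \1_[set o' | maxdist o' < 1] o.
have e_ge0 o : (0 <= exponent o)%E.
  apply: mule_ge0 => //; apply: nneseries_ge0 => k _ _.
  apply: mule_ge0; first by rewrite lee_fin invr_ge0 mulr_ge0// exprn_ge0.
  by apply: expe_ge0; exact: poweR_ge0.
have exp_le1 o : fine (expeR (- exponent o)) <= 1.
  have H : (expeR (- exponent o) <= 1)%E by rewrite -expeR0 lee_expeR leeNl oppe0.
  rewrite -[leRHS]/(fine 1%E); apply: fine_le => //.
  by rewrite ge0_fin_numE ?expeR_ge0// (le_lt_trans H)// ltry.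
have f_ge0 o : 0 <= f o.
  by rewrite mulr_ge0 ?fine_ge0 ?expeR_ge0// indicE.
have G_geN1 o : -1 <= G o by have := G_le1 o; rewrite ler_norml => /andP[].
have indic_ge0 (A : set T) o : 0 <= \1_A o :> R by rewrite indicE.
have indic1 (A : set T) o : A o -> \1_A o = 1 :> R by move=> Ao; rewrite indicE mem_set.
have fh o : f o <= h o.
  have [oN|oN] := pselect (N o).
    apply: (@le_trans _ _ 1).
      have i1 : \1_[set o' | maxdist o' < 1] o <= 1 :> R.
        by rewrite indicE; case: (_ \in _).
      by rewrite /f mulr_ile1 ?fine_ge0 ?expeR_ge0 ?indic_ge0.
    rewrite /h (indic1 N)// mulr1.
    by have := G_geN1 o; have := indic_ge0 far o; lra.
  have good i : (i < n)%N -> oU i o \in `[0, 1] /\ oV i o \in `[0, 1].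
    by move: i; apply: contrapT => /badN.
  have [near|far_o] := ltP (maxdist o) 1; last first.
    rewrite /f indicE memNset ?mulr0/=; last by apply/negP; rewrite -leNgt.
    rewrite /h (indic1 far)//.
    by have := G_geN1 o; have := indic_ge0 N o; lra.
  have dist_lt1 i : (i < n)%N -> `|X i o - Y i o| < 1.
    move=> ltin; apply: le_lt_trans near.
    exact: (le_bigmax 0 (fun i : 'I_n => `|X i o - Y i o|) (Ordinal ltin)).
  have fG : fine (expeR (- exponent o)) <= G o.
    have Xnd i j : (i <= j < n)%N -> X i o <= X j o.
      move=> ij; have /andP[lij ltjn] := ij.
      apply: (Finv_homo gamma_C2 curv_neq0 ltab F_cdf).
      - by have [] := good i (leq_ltn_trans lij ltjn).
      - by have [] := good j ltjn.
      - exact: order_stat_homo.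
    have Ynd i j : (i <= j < n)%N -> Y i o <= Y j o.
      move=> ij; have /andP[lij ltjn] := ij.
      apply: (Finv_homo gamma_C2 curv_neq0 ltab F_cdf).
      - by have [] := good i (leq_ltn_trans lij ltjn).
      - by have [] := good j ltjn.
      - exact: order_stat_homo.
    apply: le_trans (exp_exponent_le n_gt0 Xnd Ynd dist_lt1) _.
    apply: ler_prod => i _; rewrite Q_ge andbT subr_ge0 ler_pdivrMr// mul1r.
    have := dist_lt1 i (ltn_ord i); rewrite -(@ltr_pXn2r _ 2)// ?nnegrE// expr1n.
    by rewrite real_normK ?num_real// => H; rewrite (le_trans (ltW H))// ler1n.
  have := indic_ge0 far o; have := indic_ge0 N o.
  rewrite /f (indic1 [set o' | maxdist o' < 1])// mulr1 /h; lra.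
have Ef : ('E_P[f] <= \int[P]_o (h o)%:E)%E.
  rewrite unlock; apply: le_integral_ge0 => o; rewrite lee_fin//.
have iG : P.-integrable setT (EFin \o G) by exact: (@bounded_integrable _ _ _ P G 1).
have iI (A : set T) : measurable A ->
    P.-integrable setT (EFin \o (\1_A : T -> R)).
  move=> mA; apply: (@bounded_integrable _ _ _ P _ 1) => // o.
  by rewrite indicE normr_bool_le1.
have hE : (\int[P]_o (h o)%:E = (\int[P]_o G o)%:E + P far)%E.
  have i1 := iI _ mfar; have i2 := iI _ mN.
  have i3 : P.-integrable setT (EFin \o (fun o => 2 * \1_N o : R)).
    apply: (@bounded_integrable _ _ _ P _ 2) => [|o].
      by apply: measurable_funM => //; exact: measurable_indic.
    by rewrite normrM ger0_norm// ler_piMr// indicE normr_bool_le1.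
  have i12 : P.-integrable setT (EFin \o (fun o => G o + \1_far o)).
    exact: integrableD iG i1.
  have hR : \int[P]_o h o = \int[P]_o G o + fine (P far).
    rewrite /h RintegralD// RintegralD// RintegralZl// !Rintegral_indic//.
    by rewrite PN mulr0 addr0.
  rewrite -[P far]fineK ?fin_num_measure// -EFinD -hR /Rintegral fineK//.
  apply: integrable_fin_num => //; exact: integrableD i12 i3.
change ('E_P[f] - P far <= (n`!%:R ^+ 2 * hs_norm (signature gamma n) ^+ 2)%:E)%E.
rewrite -GE; apply: (@le_trans _ _ (\int[P]_o (h o)%:E - P far)%E).
  by apply: leeB.
rewrite hE addeK// fin_num_measure//.
Qed.
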